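(* The satisfiability problem and the finite satisfiability problem for modal inclusion logic $\mathcal{ML}(\subseteq)$ with lax semantics are both in $\mathrm{EXPTIME}$.
   Context: Let $\Pi$ be a countably infinite set of proposition symbols. Formulas of modal inclusion logic $\mathcal{ML}(\subseteq)$ are given by the grammar $\varphi ::= p \mid \neg p \mid (\varphi_1\wedge\varphi_2)\mid(\varphi_1\vee\varphi_2)\mid p_1\cdots p_k\subseteq q_1\cdots q_k \mid \Box\varphi\mid\Diamond\varphi$, where $p,p_i,q_i\in\Pi$ and $k\geq 1$ (negation occurs only in front of proposition symbols). A Kripke model is $M=(W,R,V)$ with $W\neq\emptyset$, $R\subseteq W\times W$, $V:\Pi\to\mathcal{P}(W)$. A team is a subset $T\subseteq W$. Let $R(T)=\{s\in W\mid \exists s'\in T: (s',s)\in R\}$ and let $R\langle T\rangle$ be the set of all $T'\subseteq W$ such that every $s\in T$ has an $R$-successor in $T'$ and every $s'\in T'$ has an $R$-predecessor in $T$. Lax team semantics $M,T\models\varphi$: $M,T\models p$ iff $T\subseteq V(p)$; $M,T\models\neg p$ iff $T\cap V(p)=\emptyset$; $M,T\models p_1\cdots p_k\subseteq q_1\cdots q_k$ iff for every $u\in T$ there is $v\in T$ with $u\in V(p_i)\Leftrightarrow v\in V(q_i)$ for all $i\in\{1,\dots,k\}$; $\wedge$ is evaluated componentwise on the same team; $M,T\models\varphi\vee\psi$ iff there are $S,S'\subseteq T$ with $S\cup S'=T$, $M,S\models\varphi$ and $M,S'\models\psi$; $M,T\models\Box\varphi$ iff $M,R(T)\models\varphi$;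 $M,T\models\Diamond\varphi$ iff $M,T'\models\varphi$ for some $T'\in R\langle T\rangle$. The satisfiability problem asks, given $\varphi$, whether there exist a Kripke model $M$ and a nonempty team $T$ with $M,T\models\varphi$; the finite satisfiability problem additionally requires $W$ to be finite. *)

(* Defs.v *)
From HB Require Import structures.
From mathcomp Require Import all_boot all_algebra.
From mathcomp Require Import boolp classical_sets cardinality.

Set Implicit Arguments.
Unset Strict Implicit.
Unset Printing Implicit Defensive.

Local Open Scope classical_set_scope.

Inductive form (Pi : Type) : Type :=
| Pos of Pi
| Neg of Pi
| And of form Pi & form Pi
| Or of form Pi & form Pi
| Incl (k : nat) of k.+1.-tuple Pi & k.+1.-tuple Pi
| Box of form Pi
| Dia of form Pi.

Record kripke (Pi : Type) := Kripke {
  world :> Type;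
  world_inh : inhabited world;
  access : world -> world -> Prop;
  valuation : Pi -> set world
}.

Definition succ_team Pi (M : kripke Pi) (T : set M) : set M :=
  [set s | exists2 s', T s' & access s' s].

Definition lax_succ Pi (M : kripke Pi) (T : set M) : set (set M) :=
  [set T' | (forall s, T s -> exists2 s', T' s' & access s s')
         /\ (forall s', T' s' -> exists2 s, T s & access s s')].

Fixpoint holds Pi (M : kripke Pi) (T : set M) (phi : form Pi) {struct phi} : Prop :=
  match phi with
  | Pos p => T `<=` valuation p
  | Neg p => T `&` valuation p = set0
  | And a b => holds T a /\ holds T b
  | Or a b => exists S S' : set M,
      [/\ S `<=` T, S' `<=` T, S `|` S' = T, holds S a & holds S' b]
  | Incl k ps qs => forall u, T u -> exists2 v, T v &
      forall i : 'I_k.+1, valuation (tnth ps i) u <-> valuation (tnth qs i) v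
  | Box a => holds (succ_team T) a
  | Dia a => exists2 T', lax_succ T T' & holds T' a
  end.

Definition satisfiable Pi (phi : form Pi) : Prop :=
  exists (M : kripke Pi) (T : set M), T !=set0 /\ holds T phi.

Definition fin_satisfiable Pi (phi : form Pi) : Prop :=
  exists (M : kripke Pi) (T : set M),
    [/\ finite_set [set: M], T !=set0 & holds T phi].

Inductive dir := Left | Stay | Right.

(* The tape symbols are the input symbols, further work symbols, and the blank
   [None]; there are [tm_extra.+1] tapes. *)
Definition tape_sym (A B : finType) : finType := option (A + B)%type.

Record tm (A : finType) := TM {
  tm_work : finType;
  tm_extra : nat;
  tm_state : finType;
  tm_start : tm_state;
  (* [Some true]: halt and accept; [Some false]: halt and reject. *)
  tm_verdict : tm_state -> option bool;
  tm_delta : tm_state -> {ffun 'I_tm_extra.+1 -> tape_sym A tm_work} ->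
             tm_state * ('I_tm_extra.+1 -> tape_sym A tm_work * dir)
}.

Record tape (G : Type) := Tape { cell : int -> G; head : int }.

Definition tape_read G (t : tape G) : G := cell t (head t).

Definition tape_act G (t : tape G) (ad : G * dir) : tape G :=
  Tape (fun z => if z == head t then ad.1 else cell t z)
       (match ad.2 with
        | Left => head t - 1
        | Stay => head t
        | Right => head t + 1
        end)%R.

Record config (A : finType) (M : tm A) := Config {
  cf_state : tm_state M;
  cf_tapes : 'I_(tm_extra M).+1 -> tape (tape_sym A (tm_work M))
}.

Definition tm_step (A : finType) (M : tm A) (c : config M) : config M :=
  if tm_verdict (cf_state c) is Some _ then c else
  let: (q, w) := tm_delta (cf_state c) [ffun i => tape_read (cf_tapes c i)] in
  Config q (fun i => tape_act (cf_tapes c i) (w i)).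

Definition input_tape (A B : finType) (s : seq A) : tape (tape_sym A B) :=
  Tape (fun z => if z is Posz n then omap inl (onth s n) else None) 0%R.

Definition blank_tape (A B : finType) : tape (tape_sym A B) := Tape (fun=> None) 0%R.

Definition tm_init (A : finType) (M : tm A) (s : seq A) : config M :=
  Config (tm_start M)
    (fun i => if i == ord0 then input_tape _ s else blank_tape _ _).

Definition decides_within (A : finType) (M : tm A) (L : set (seq A)) (time : nat -> nat) :=
  forall s : seq A, exists t b,
    [/\ (t <= time (size s))%N,
        tm_verdict (cf_state (iter t (@tm_step A M) (tm_init M s))) = Some b
      & b = true <-> L s].

Definition EXPTIME (A : finType) (L : set (seq A)) : Prop :=
  exists (M : tm A) (p : {poly nat}), decides_within M L (fun n => 2 ^ p.[n]%R).

Inductive sym :=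
  SyBit of bool | SyProp | SyNeg | SyAnd | SyOr | SyIncl | SySub | SyBox | SyDia.

Definition sym_code (x : sym) : bool + 'I_8 :=
  match x with
  | SyBit b => inl b
  | SyProp => inr (inord 0) | SyNeg => inr (inord 1) | SyAnd => inr (inord 2)
  | SyOr => inr (inord 3) | SyIncl => inr (inord 4) | SySub => inr (inord 5)
  | SyBox => inr (inord 6) | SyDia => inr (inord 7)
  end.

Definition sym_decode (c : bool + 'I_8) : sym :=
  match c with
  | inl b => SyBit b
  | inr i => nth SyProp
      [:: SyProp; SyNeg; SyAnd; SyOr; SyIncl; SySub; SyBox; SyDia] i
  end.

Lemma sym_codeK : cancel sym_code sym_decode.
Proof. by case=> //=; rewrite inordK. Qed.

HB.instance Definition _ := Equality.copy sym (can_type sym_codeK).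
HB.instance Definition _ := Choice.copy sym (can_type sym_codeK).
HB.instance Definition _ := Countable.copy sym (can_type sym_codeK).
HB.instance Definition _ := Finite.copy sym (can_type sym_codeK).

(* [name] assigns to each proposition symbol the binary word by which it is
   written; formulas are then written in Polish notation.  An inclusion atom is
   written [SyIncl p_1 ... p_k SySub q_1 ... q_k]. *)
Definition enc_prop Pi (name : Pi -> seq bool) (p : Pi) : seq sym :=
  SyProp :: map SyBit (name p).

Fixpoint enc Pi (name : Pi -> seq bool) (phi : form Pi) : seq sym :=
  match phi with
  | Pos p => enc_prop name p
  | Neg p => SyNeg :: enc_prop name p
  | And a b => SyAnd :: enc name a ++ enc name b
  | Or a b => SyOr :: enc name a ++ enc name b
  | Incl _ ps qs => SyIncl :: flatten (map (enc_prop name) ps)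
                      ++ SySub :: flatten (map (enc_prop name) qs)
  | Box a => SyBox :: enc name a
  | Dia a => SyDia :: enc name a
  end.

Definition SAT Pi (name : Pi -> seq bool) : set (seq sym) :=
  [set enc name phi | phi in @satisfiable Pi].

Definition FINSAT Pi (name : Pi -> seq bool) : set (seq sym) :=
  [set enc name phi | phi in @fin_satisfiable Pi].

(* Main.v *)
(* A formula is satisfied by a nonempty team iff teams can be attached to all its
   subformula occurrences such that local conditions between worlds hold.
   The condition at a box also constrains the edges; the conditions at diamonds,
   boxes and inclusion atoms also demand, of each world of a team, a suitable
   successor, predecessor or companion.  A world thus contributes a type, namely
   the input word with two bits attached to each position.  Starting from all
   such words, one repeatedly deletes those that are locally inconsistent or
   have a demand that no remaining word meets.  The types of the worlds of a model
   are never deleted; conversely the words that survive form a finite model, with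
   all edges that the boxes admit.  So satisfiability and finite satisfiability
   coincide, and there are only 4^n words for an input of length n.

   The elimination is carried out by a structured program on stacks, which is
   compiled to a multi-tape Turing machine.  If each loop of a program performs
   at most B iterations, the machine stops within c * (B + 1)^d steps, where c
   and d depend on the program only; here B is exponential in n. *)

From HB Require Import structures.
From Stdlib Require Import Btauto.
Require Import Defs.
From mathcomp Require Import all_boot all_algebra.
From mathcomp Require Import boolp classical_sets cardinality.
From mathcomp Require Import zify.

Set Implicit Arguments.
Unset Strict Implicit.
Unset Printing Implicit Defensive.

(** * Stack programs and their compilation to Turing machines *)

(** Lax semantics is what makes the conditions local: a successor team may contain any number of
    successors of a world and the parts of a split may overlap, so all worlds carrying a bit can
    serve as the team, and every demand can be met separately. Different demands of a word may need
    different witnesses, hence words are compared once per marked position and per edge direction.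
    Diamonds have demands in both directions; a box has only the backward one, since its forward
    half is the condition on edges; the companion of an inclusion atom need not be adjacent. One
    condition links distant positions: all occurrences of a proposition symbol have the same truth
    bit. It is tested separately, by comparing names. The input need not encode a formula. The scan
    is therefore also a parser of Polish notation, and on an ill-formed nonempty input every
    comparison fails, so that no word survives. *)

Section StackPrograms.
Variables (A W : finType) (k : nat).

Notation var := 'I_k.+1.
Notation G := (A + W)%type.

Definition store := var -> seq G.

Definition upd (s : store) (a : var) (l : seq G) : store :=
  fun v => if Nat.eqb v a then l else s v.

Lemma updE s a l v : upd s a l v = if v == a then l else s v.
Proof. by rewrite /upd -val_eqE /=; congr (if _ then _ else _). Qed.

Inductive action := Keep | Pop | Push of G | Repl of G.

Definition action_fun (a : action) (l : seq G) : seq G :=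
  match a with
  | Keep => l
  | Pop => behead l
  | Push g => g :: l
  | Repl g => g :: behead l
  end.

Definition tops (s : store) : var -> option G := fun v => ohead (s v).

Definition act (d : (var -> option G) -> var -> action) (s : store) : store :=
  fun v => action_fun (d (tops s) v) (s v).

(* [Loop v b] pops a symbol [c] from the stack [v] and runs [b c], until [v] is
   empty. *)
Inductive prog :=
| Act of ((var -> option G) -> var -> action)
| Seq of prog & prog
| If of ((var -> option G) -> bool) & prog & prog
| Loop of var & (G -> prog).

(* Besides establishing [Q], the precondition bounds every loop by [B]
   iterations: the stack of a loop has at most [B] symbols when the loop is
   entered and is restored by each execution of the body. *)
Fixpoint wp (B : nat) (p : prog) (s : store) (Q : store -> Prop) {struct p} : Prop :=
  match p with
  | Act d => Q (act d s)
  | Seq p1 p2 => wp B p1 s (fun s1 => wp B p2 s1 Q)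
  | If t p1 p2 => if t (tops s) then wp B p1 s Q else wp B p2 s Q
  | Loop v b => size (s v) <= B /\
      (fix loop (l : seq G) (s : store) : Prop :=
         match l with
         | [::] => Q s
         | c :: l' =>
             wp B (b c) (upd s v l') (fun s1 => s1 v = l' /\ loop l' s1)
         end) (s v) s
  end.

(** Inside [wp] this recursion has to be anonymous because it is nested in the recursion on
    programs; the named copy is what inductions on the popped stack refer to. *)
Fixpoint wp_loop (B : nat) (v : var) (b : G -> prog) (Q : store -> Prop)
    (l : seq G) (s : store) : Prop :=
  match l with
  | [::] => Q s
  | c :: l' => wp B (b c) (upd s v l') (fun s1 => s1 v = l' /\ wp_loop B v b Q l' s1)
  end.

Lemma wp_loopE B v b s Q :
  wp B (Loop v b) s Q = (size (s v) <= B /\ wp_loop B v b Q (s v) s).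
Proof.
rewrite /=; congr (_ /\ _); move: (s v) => l; elim: l s => [|c l IHl] s //=.
by congr (wp _ _ _ _); apply: funext => s1; rewrite IHl.
Qed.

(** A machine with one entry and one exit: the next state [None] hands control to the surrounding
    machine, in the same step in which the tapes are written. *)
Record frag := Frag {
  fq : finType;
  fq0 : fq;
  ftr : fq -> {ffun var -> option G} -> option fq * (var -> option G * dir) }.

Notation tapes := (var -> tape (option G)).

Definition fread (T : tapes) : {ffun var -> option G} :=
  [ffun v => tape_read (T v)].

Definition fwrite (T : tapes) (w : var -> option G * dir) : tapes :=
  fun v => tape_act (T v) (w v).

Inductive exits (F : frag) : nat -> fq F -> tapes -> tapes -> Prop :=
| Exits1 q T w : ftr q (fread T) = (None, w) -> exits 1 q T (fwrite T w)
| ExitsS n q T q' w T' : ftr q (fread T) = (Some q', w) ->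
    exits n q' (fwrite T w) T' -> exits n.+1 q T T'.

Definition stay (r : {ffun var -> option G}) : var -> option G * dir :=
  fun v => (r v, Stay).

Definition seq_frag (F1 F2 : frag) : frag :=
  @Frag (fq F1 + fq F2)%type (inl (fq0 F1)) (fun q r =>
    match q with
    | inl q1 => let: (o, w) := ftr q1 r in
        (Some (if o is Some q' then inl q' else inr (fq0 F2)), w)
    | inr q2 => let: (o, w) := ftr q2 r in (omap inr o, w)
    end).

Definition if_frag (t : (var -> option G) -> bool) (F1 F2 : frag) : frag :=
  @Frag (option (fq F1 + fq F2)%type) None (fun q r =>
    match q with
    | None => (Some (Some (if t (fun v => r v) then inl (fq0 F1) else inr (fq0 F2))),
               stay r)
    | Some (inl q1) => let: (o, w) := ftr q1 r in (omap (Some \o inl) o, w)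
    | Some (inr q2) => let: (o, w) := ftr q2 r in (omap (Some \o inr) o, w)
    end).

(** Each symbol has its own copy of the body, so the popped symbol is remembered in the control
    state. Popping only moves the head; the symbol stays on the tape to the left of the stack. *)
Definition loop_frag (v : var) (F : G -> frag) : frag :=
  @Frag (option {g : G & fq (F g)}) None (fun q r =>
    match q with
    | None =>
        if r v is Some g then
          (Some (Some (Tagged (fun g => fq (F g)) (fq0 (F g)))),
           fun u => (r u, if u == v then Right else Stay))
        else (None, stay r)
    | Some (existT g q) => let: (o, w) := @ftr (F g) q r in
        (Some (omap (Tagged (fun g => fq (F g))) o), w)
    end).

(* Pushing takes two steps: the head moves to the left before it writes. *)
Definition act_frag (d : (var -> option G) -> var -> action) : frag :=
  @Frag (option {ffun var -> option G}) None (fun q r =>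
    match q with
    | None => let a := d (fun v => r v) in
        (Some (Some [ffun v => if a v is Push g then Some g else None]),
         fun v => match a v with
                  | Keep => (r v, Stay)
                  | Pop => (r v, Right)
                  | Push _ => (r v, Left)
                  | Repl g => (Some g, Stay)
                  end)
    | Some f => (None, fun v => (if f v is Some g then Some g else r v, Stay))
    end).

Fixpoint compile (p : prog) : frag :=
  match p with
  | Act d => act_frag d
  | Seq p1 p2 => seq_frag (compile p1) (compile p2)
  | If t p1 p2 => if_frag t (compile p1) (compile p2)
  | Loop v b => loop_frag v (fun g => compile (b g))
  end.

(** [coef p * (B + 1) ^ deg p] will bound the running time, with sums over branches and symbols in
    place of maxima. For a loop, the [.+1] inside the sum pays for the popping step and the outer
    one for the final test on the empty stack. *)
Fixpoint coef (p : prog) : nat :=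
  match p with
  | Act _ => 2
  | Seq p1 p2 => coef p1 + coef p2
  | If _ p1 p2 => (coef p1 + coef p2).+1
  | Loop v b => (\sum_(g : G) (coef (b g)).+1).+1
  end.

Fixpoint deg (p : prog) : nat :=
  match p with
  | Act _ => 0
  | Seq p1 p2 => deg p1 + deg p2
  | If _ p1 p2 => deg p1 + deg p2
  | Loop v b => (\sum_(g : G) deg (b g)).+1
  end.

Lemma exits_seq_inl (F1 F2 : frag) n m q T T' T'' :
  exits n q T T' -> exits m (fq0 F2) T' T'' ->
  @exits (seq_frag F1 F2) (n + m) (inl q) T T''.
Proof.
elim=> {n q T T'} [q T w E|n q T q' w T' E _ IH] E2; rewrite ?addSn ?add0n.
- apply: ExitsS; first by rewrite /= E.
  elim: E2 => {m E} [q2 T2 w2 E|n q2 T2 q2' w2 T2' E _ IH2].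
  + by apply: Exits1; rewrite /= E.
  + by apply: ExitsS; [rewrite /= E | apply: IH2].
- by apply: ExitsS; [rewrite /= E | apply: IH].
Qed.

Lemma exits_if (t : (var -> option G) -> bool) (F1 F2 : frag) n (b : bool) (T T' : tapes) :
  t (fun v => fread T v) = b ->
  (if b then exits n (fq0 F1) (fwrite T (stay (fread T))) T'
   else exits n (fq0 F2) (fwrite T (stay (fread T))) T') ->
  @exits (if_frag t F1 F2) n.+1 None T T'.
Proof.
move=> tb H; apply: ExitsS; first by rewrite /= tb.
case: b H {tb}.
- elim=> {n T'} [q T1 w E|n q T1 q' w T' E _ IH].
  + by apply: Exits1; rewrite /= E.
  + by apply: ExitsS; [rewrite /= E | apply: IH].
- elim=> {n T'} [q T1 w E|n q T1 q' w T' E _ IH].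
  + by apply: Exits1; rewrite /= E.
  + by apply: ExitsS; [rewrite /= E | apply: IH].
Qed.

Lemma exits_loop (v : var) (F : G -> frag) g n m (q : fq (F g)) (T T' T'' : tapes) :
  exits n q T T' -> @exits (loop_frag v F) m None T' T'' ->
  @exits (loop_frag v F) (n + m) (Some (Tagged (fun g => fq (F g)) q)) T T''.
Proof.
elim=> {n q T T'} [q T w E|n q T q' w T' E _ IH] E2; rewrite ?addSn ?add0n.
- by apply: (ExitsS _ E2); rewrite /= E.
- by apply: ExitsS; [rewrite /= E | apply: IH].
Qed.

(* The top of a stack is under the head and the rest lies to its right, so the
   input tape already is a stack. *)
Definition rep (T : tapes) (s : store) : Prop :=
  forall v (i : nat), cell (T v) (Defs.head (T v) + i%:Z)%R = onth (s v) i.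

Lemma rep_read T s : rep T s -> forall v, fread T v = ohead (s v).
Proof.
by move=> TS v; have := TS v 0%N; rewrite GRing.addr0 ffunE /tape_read => ->; case: (s v).
Qed.

Lemma rep_tops T s : rep T s -> (fun v => fread T v) = tops s.
Proof. by move=> TS; apply: funext => v; rewrite (rep_read TS). Qed.

Lemma rep_stay T s : rep T s -> rep (fwrite T (stay (fread T))) s.
Proof.
move=> TS v i; rewrite /fwrite /stay /= ffunE /tape_read; case: eqP => [E|_]; last exact: TS.
by rewrite -(TS v i) E.
Qed.

Lemma rep_pop (T : tapes) (s : store) v c l : rep T s -> s v = c :: l ->
  rep (fwrite T (fun u => (fread T u, if u == v then Right else Stay))) (upd s v l).
Proof.
move=> TS sv u i; rewrite /fwrite /= ffunE /tape_read.
rewrite updE; case: (u =P v) => [->|_] /=.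
  case: eqP => [|_]; first by lia.
  by have /= := TS v i.+1; rewrite sv /= => <-; congr (cell _); lia.
case: eqP => [E|_]; last exact: TS.
by rewrite -(TS u i) E.
Qed.

Lemma rep_act d T s : rep T s ->
  exists2 T', exits 2 (fq0 (act_frag d)) T T' & rep T' (act d s).
Proof.
move=> TS; eexists.
  apply: ExitsS; first by [].
  exact: Exits1.
move=> v i; rewrite /fwrite /= !ffunE /tape_read /act.
rewrite (rep_tops TS).
move: (TS v); case: (T v) => c h /= H; move: (s v) H => l H.
case: (d (tops s) v) => [||g|g] /=; rewrite ?eqxx.
- by rewrite -(H i); case: eqP => [->|].
- have -> : onth (behead l) i = c (h + 1 + i)%R.
    have -> : (h + 1 + i%:Z)%R = (h + i.+1%:Z)%R by lia.
    by rewrite H; case: (l) => [|? ?]; rewrite ?onth0n.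
  by case: eqP => [->|_]; case: eqP => [->|].
- case: i => [|i]; first by rewrite GRing.addr0 eqxx.
  have -> : (h - 1 + i.+1%:Z)%R = (h + i%:Z)%R by lia.
  by rewrite /= -(H i); case: eqP => [|_]; [lia | case: eqP => [->|]].
- case: i => [|i]; first by rewrite GRing.addr0 eqxx.
  by case: eqP => [|_]; [lia | rewrite H; case: (l) => //=; rewrite onth0n].
Qed.

Lemma compile_correct B p s Q T : wp B p s Q -> rep T s ->
  exists n T' s', [/\ exits n (fq0 (compile p)) T T', n <= coef p * B.+1 ^ deg p,
                      rep T' s' & Q s'].
Proof.
elim: p s Q T => [d|p1 IH1 p2 IH2|t p1 IH1 p2 IH2|v b IH] s Q T.
- by move=> Qs /(rep_act d) [T' E R]; exists 2, T', (act d s); split.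
- move=> /= H TS; have [n1 [T1 [s1 [E1 L1 TS1 H1]]]] := IH1 _ _ _ H TS.
  have [n2 [T2 [s2 [E2 L2 TS2 H2]]]] := IH2 _ _ _ H1 TS1.
  exists (n1 + n2), T2, s2; split=> //; first exact: exits_seq_inl E2.
  rewrite mulnDl leq_add //.
  + by rewrite (leq_trans L1) // leq_mul2l leq_pexp2l ?orbT // leq_addr.
  + by rewrite (leq_trans L2) // leq_mul2l leq_pexp2l ?orbT // leq_addl.
- move=> /= H TS.
  have bnd n (c d : nat) : c <= coef p1 + coef p2 -> d <= deg p1 + deg p2 ->
      n <= c * B.+1 ^ d -> n.+1 <= (coef p1 + coef p2).+1 * B.+1 ^ (deg p1 + deg p2).
    move=> Lc Ld Ln; rewrite mulSn -[n.+1]add1n leq_add ?expn_gt0 //.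
    by rewrite (leq_trans Ln) // leq_mul // leq_pexp2l.
  case tb : (t (tops s)) H => H.
  + have [n1 [T1 [s1 [E1 L1 TS1 H1]]]] := IH1 _ _ _ H (rep_stay TS).
    exists n1.+1, T1, s1; split => //; last by apply: bnd L1; rewrite leq_addr.
    by apply: (@exits_if t _ _ n1 true); rewrite ?(rep_tops TS).
  + have [n1 [T1 [s1 [E1 L1 TS1 H1]]]] := IH2 _ _ _ H (rep_stay TS).
    exists n1.+1, T1, s1; split => //; last by apply: bnd L1; rewrite leq_addl.
    by apply: (@exits_if t _ _ n1 false); rewrite ?(rep_tops TS).
- rewrite wp_loopE => -[sB H] TS.
  set C := \sum_(g : G) (coef (b g)).+1; set D := \sum_(g : G) deg (b g).
  (* The induction counts with the actual size of the stack; replacing it by [B] afterwards costs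
     the additional degree of a loop. *)
  suff: exists n T' s', [/\ exits n (fq0 (compile (Loop v b))) T T',
       n <= (size (s v) * C).+1 * B.+1 ^ D, rep T' s' & Q s'].
    move=> [n [T' [s' [E L R q]]]]; exists n, T', s'; split=> //.
    apply: (leq_trans L); change ((size (s v) * C).+1 * B.+1 ^ D <= C.+1 * B.+1 ^ D.+1).
    rewrite expnS mulnA leq_mul2r; apply/orP; right.
    apply: (@leq_trans (B * C).+1); first by rewrite ltnS leq_mul2r sB orbT.
    have -> : C.+1 * B.+1 = (B * C + (B + C)).+1 by rewrite mulSn mulnS mulnC; lia.
    by rewrite ltnS leq_addr.
  have sv : s v = s v by [].
  move: {-2}(s v) sv H => l; elim: l s T TS {sB} => [|c l IHl] s T TS sv /= H.
    exists 1, (fwrite T (stay (fread T))), s; split=> //; last exact: rep_stay.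
    + by apply: Exits1; rewrite /= (rep_read TS) -sv.
    + by rewrite mul0n mul1n expn_gt0.
  have [n1 [T1 [s1 [E1 L1 TS1 [Hv H1]]]]] := IH _ _ _ _ H (rep_pop TS (esym sv)).
  have [n2 [T2 [s2 [E2 L2 TS2 H2]]]] := IHl _ _ TS1 (esym Hv) H1.
  exists (n1 + n2).+1, T2, s2; split=> //.
    apply: ExitsS; first by rewrite /= (rep_read TS) -sv.
    by apply: exits_loop E2.
  have LC : (coef (b c)).+1 <= C.
    by rewrite /C (bigD1 c) //= leq_addr.
  have LD : deg (b c) <= D by rewrite /D (bigD1 c) //= leq_addr.
  have L3 : n1.+1 <= C * B.+1 ^ D.
    apply: (@leq_trans ((coef (b c)).+1 * B.+1 ^ D)); last by rewrite leq_mul2r LC orbT.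
    rewrite mulSn -[n1.+1]add1n leq_add ?expn_gt0 //.
    by rewrite (leq_trans L1) // leq_mul2l leq_pexp2l ?orbT.
  have -> : ((size l).+1 * C).+1 = C + (size l * C).+1 by rewrite mulSn addnS.
  by rewrite -addSn mulnDl leq_add.
Qed.

Definition input_store (w : seq A) : store :=
  fun v => if v == ord0 then map inl w else [::].

(** The exit of the program leads to the undecided state [inr None], in which the top of [out] is
    read: a nonempty stack means acceptance. *)
Definition prog_tm (p : prog) (out : var) : tm A :=
  @TM A W k (fq (compile p) + option bool)%type (inl (fq0 (compile p)))
    (fun q => if q is inr o then o else None)
    (fun q r => match q with
       | inl q' => let: (o, w) := ftr q' r in
           (if o is Some q'' then inl q'' else inr None, w)
       | inr _ => (inr (Some (r out != None)), stay r)
       end).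

Lemma prog_tm_run p out n q T T' : exits n q T T' ->
  iter n.+1 (@tm_step A (prog_tm p out)) (Config (M := prog_tm p out) (inl q) T) =
  Config (M := prog_tm p out) (inr (Some (fread T' out != None)))
    (fwrite T' (stay (fread T'))).
Proof.
elim=> {n q T T'} [q T w E|n q T q' w T' E _ IH].
- by rewrite !iterSr /= {2}/tm_step /= -/(fread T) E.
- by rewrite iterSr -IH {2}/tm_step /= -/(fread T) E.
Qed.

Lemma rep_init w : rep (fun i => if i == ord0 then input_tape _ w else blank_tape _ _)
  (input_store w).
Proof.
move=> v i; rewrite /input_store; case: eqP => _; last by rewrite onth0n.
change (cell (input_tape W w) (0 + i%:Z)%R = onth (map inl w) i); rewrite GRing.add0r /=.
by rewrite onth_map.
Qed.

Theorem prog_EXPTIME (p : prog) (out : var) (L : set (seq A)) (a b : nat) :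
  (forall w : seq A, wp (2 ^ (a * size w + b)) p (input_store w)
     (fun s => (s out != [::]) <-> L w)) ->
  EXPTIME L.
Proof.
move=> H; pose c := coef p; pose d := deg p.
(* With [B = 2 ^ (a * n + b)], the estimate [B + 1 <= 2 ^ (a * n + b + 1)] contributes [(b + 1) * d]
   to the constant term, and [c + 1 <= 2 ^ c] absorbs the coefficient and the final step. *)
exists (prog_tm p out), ((a * d)%:P * 'X + (c + (b + 1) * d + 1)%:P)%R => w.
have [n [T [s [E Ln R Q]]]] := compile_correct (H w) (rep_init w).
rewrite -/c -/d in Ln; exists n.+1, (s out != [::]); split; last exact: Q.
- rewrite hornerMXaddC hornerC.
  rewrite (leq_trans (n := (c * 2 ^ ((a * size w + b).+1 * d)).+1)) //.
    rewrite ltnS (leq_trans Ln) // leq_mul2l; apply/orP; right.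
    rewrite expnM; case: (posnP d) => [->|d0] //; rewrite leq_exp2r //.
    by rewrite expnS mul2n -addnn -addn1 leq_add // expn_gt0.
  rewrite (leq_trans (n := c.+1 * 2 ^ ((a * size w + b).+1 * d))) //.
    by rewrite mulSn -add1n leq_add2r expn_gt0.
  rewrite (leq_trans (n := 2 ^ c * 2 ^ ((a * size w + b).+1 * d))) //.
    by rewrite leq_mul2r ltn_expl ?orbT.
  rewrite -expnD leq_exp2l // /GRing.add /GRing.mul /=; nia.
- rewrite [iter _ _ _](prog_tm_run out E) /=.
  by rewrite (rep_read R); case: (s out).
Qed.

End StackPrograms.

Arguments wp : simpl never.

(** * Elimination of annotated words *)

(* The bits attached to a position say whether the world is in the team of the
   subformula that starts there, and whether the proposition symbol written
   there is true. *)
Notation bits := (bool * bool)%type.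
Notation asym := (sym * bits)%type.

(* A parsed subformula: whether it is a proposition symbol, and its bits in the
   two words that are compared. *)
Notation item := (bool * (bits * bits))%type.

(* The control state of the comparison of a word [t] with a word [t'].
   [ok]: no error so far.  [ed]: the boxes admit an edge between the two words.
   [pm]: inside the left-hand side of an inclusion atom.  [nm]: inside the name
   of a proposition symbol.  [rs], [ne]: [t'] meets the demand of [t] at the
   marked position, provided that there is an edge if [ne].  [top]: the top of
   the stack of parsed subformulas.  [mt]: the inclusion atom being compared
   is satisfied by [t']. *)
Record reg := Reg {
  ok : bool; ed : bool; pm : bool; nm : bool; rs : bool; ne : bool;
  top : option item; mt : option bool }.

Definition reg_code r :=
  (ok r, ed r, pm r, nm r, rs r, ne r, top r, mt r).
Definition reg_decode c :=
  let: (a, b, c, d, e, f, g, h) := c in Reg a b c d e f g h.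
Lemma reg_codeK : cancel reg_code reg_decode. Proof. by case. Qed.

HB.instance Definition _ := Equality.copy reg (can_type reg_codeK).
HB.instance Definition _ := Choice.copy reg (can_type reg_codeK).
HB.instance Definition _ := Countable.copy reg (can_type reg_codeK).
HB.instance Definition _ := Finite.copy reg (can_type reg_codeK).

Definition reg0 := Reg true true false false true false None None.

(* In the functions below [fwd] tells whether edges from [t] to [t'] or from
   [t'] to [t] are considered, and [k] marks the position whose demand is
   examined. *)
Definition step_reg (fwd : bool) (c : sym) (b b' : bits) (k : bool) (r : reg)
    (f : option item) : reg :=
  let: Reg ok ed pm nm rs ne top mt := r in
  let m := b.1 in let v := b.2 in let m' := b'.1 in
  let bad := Reg false ed pm nm rs ne top mt in
  let new := Some (false, (b, b')) in
  let ok1 := [&& ok, ~~ nm & ~~ pm] in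
  match c with
  | SyBit _ => Reg ok ed pm true rs ne top mt
  | SyProp => Reg (ok && (m ==> v)) ed pm false rs ne
                (if pm then top else Some (true, (b, b'))) mt
  | SySub => Reg ok1 ed true nm rs ne top mt
  | SyIncl => Reg [&& ok, ~~ nm, pm & isSome mt] ed false nm
      (rs && (k ==> fwd ==> (m ==> m' && odflt false mt))) ne new None
  | SyNeg => if top is Some (true, ((_, v0), _))
      then Reg (ok1 && (m ==> ~~ v0)) ed pm nm rs ne new mt else bad
  | SyAnd => if (top, f) is (Some (_, ((m1, _), _)), Some (_, ((m2, _), _)))
      then Reg (ok1 && ((m == m1) && (m == m2))) ed pm nm rs ne new mt else bad
  | SyOr => if (top, f) is (Some (_, ((m1, _), _)), Some (_, ((m2, _), _)))
      then Reg (ok1 && (m == m1 || m2)) ed pm nm rs ne new mt else bad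
  | SyBox => if top is Some (_, ((m1, _), (m1', _)))
      then Reg ok1 (ed && if fwd then m ==> m1' else m' ==> m1) pm nm
        (rs && (k ==> fwd || (m1 ==> m'))) (ne || [&& k, ~~ fwd & m1]) new mt
      else bad
  | SyDia => if top is Some (_, ((m1, _), (m1', _)))
      then Reg ok1 ed pm nm
        (rs && (k ==> if fwd then m ==> m1' else m1 ==> m'))
        (ne || (k && if fwd then m else m1)) new mt
      else bad
  end.

(** The top of the stack of parsed items sits in the register and [F] is the rest. A unary operator
    therefore leaves [F] alone, a binary one pops it, and a new atom pushes the previous top. *)
Definition pops (c : sym) : bool :=
  match c with SyAnd | SyOr => true | _ => false end.

Definition pushes (c : sym) (r : reg) : option item :=
  match c with
  | SyProp => if pm r then None else top r
  | SyIncl => top r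
  | _ => None
  end.

Definition pushesP (c : sym) (b b' : bits) (r : reg) : option item :=
  match c with
  | SyProp => if pm r then Some (true, (b, b')) else None
  | _ => None
  end.

Definition ocons T (x : option T) (l : seq T) := if x is Some y then y :: l else l.

Definition step_col fwd (z : sym * bits * bits * bool) (st : reg * seq item * seq item) :=
  let: (c, b, b', k) := z in let: (r, F, P) := st in
  (step_reg fwd c b b' k r (ohead F),
   if pops c then behead F else ocons (pushes c r) F,
   ocons (pushesP c b b' r) P).

Definition cmp_reg (p : item) (r : reg) (f : option item) : reg :=
  let: Reg ok ed pm nm rs ne top mt := r in
  if top is Some (true, (_, (_, v'))) then
    Reg ok ed pm nm rs ne f (Some (odflt true mt && (p.2.1.2 == v')))
  else Reg false ed pm nm rs ne top mt.

Definition cmp_step (st : reg * seq item) (p : item) :=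
  (cmp_reg p st.1 (ohead st.2), behead st.2).

(** When [SyIncl] is reached, the right-hand symbols of the atom are on the main stack and the
    left-hand ones in [P]. They are paired off only here, since the length of [P] decides how many
    items of the main stack belong to the atom. *)
Definition scan_col fwd (z : sym * bits * bits * bool) (st : reg * seq item * seq item) :=
  if z.1.1.1 is SyIncl then
    let: (r, F) := foldl cmp_step st.1 st.2 in step_col fwd z (r, F, [::])
  else step_col fwd z st.

Fixpoint scan fwd (t t' : seq asym) (K : seq bool) (st : reg * seq item * seq item) :=
  if t is (c, b) :: u then
    scan fwd u (behead t') (behead K)
      (scan_col fwd (c, b, (head (SyProp, (false, false)) t').2, head false K) st)
  else st.

Definition accepting (r : reg) (f : option item) : bool :=
  [&& ok r, ~~ pm r, ~~ nm r, isSome (top r), ~~ isSome f, rs r & (ne r ==> ed r)].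

Definition accepting_state (st : reg * seq item * seq item) : bool :=
  accepting st.1.1 (ohead st.1.2).

(* Words are scanned from right to left, so that the arguments of an operator
   have been parsed when it is reached. *)
Definition pass fwd (K : seq bool) (t t' : seq asym) : bool :=
  accepting_state (scan fwd (rev t) (rev t') K (reg0, [::], [::])).

Fixpoint bit_prefix (w : seq sym) : seq bool :=
  if w is SyBit b :: w' then b :: bit_prefix w' else [::].

Definition conflict (c : asym) (u : seq asym) (d : asym) (v : seq asym) : bool :=
  [&& c.1 == SyProp, d.1 == SyProp, c.2.2 != d.2.2 &
      bit_prefix (map fst u) == bit_prefix (map fst v)].

Fixpoint conflict_in (c : asym) (u t : seq asym) : bool :=
  if t is d :: v then conflict c u d v || conflict_in c u v else false.

Fixpoint conflicts (t0 t : seq asym) : bool :=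
  if t is c :: u then conflict_in c u t0 || conflicts t0 u else false.

(* Marks the [i]-th position from the right. *)
Definition marker (i : nat) : seq bool := rcons (nseq i false) true.

(** Each pass also checks the syntax and the local conditions of [t], so these need no test of their
    own; only the empty word undergoes no pass. *)
Definition good (L : seq (seq asym)) (t : seq asym) : bool :=
  ~~ conflicts t t && all (fun i => has (pass true (marker i) t) L &&
                                    has (pass false (marker i) t) L) (iota 0 (size t)).

(* The reversal only reflects the order in which the program stacks the words. *)
Definition round (L : seq (seq asym)) := rev (filter (good L) L).

Definition root_in_team (t : seq asym) : bool := if t is c :: _ then c.2.1 else false.

(** * Stabilization of the rounds *)

Section Elimination.

Lemma good_rev L : good (rev L) =1 good L.
Proof.
by move=> t; rewrite /good; congr (_ && _); apply: eq_all => i; rewrite !has_rev.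
Qed.

(** A round that is not yet stable deletes at least one word, and a stable list is only reversed,
    which does not affect [good]. So as many rounds as there are words suffice: after that many
    deletions the list is empty. *)
Lemma iter_round N L : all (good (iter N round L)) (iter N round L) \/
  size (iter N round L) + N <= size L.
Proof.
elim: N => [|N IH]; first by right; rewrite addn0.
rewrite iterS; set L' := iter N round L in IH *.
case: (boolP (all (good L') L')) => [H|nH].
  by left; rewrite /round (all_filterP H) all_rev (eq_all (good_rev L')).
right; case: IH => [H|IH]; first by rewrite H in nH.
apply: leq_trans IH; rewrite addnS -addSn leq_add2r /round size_rev size_filter.
by rewrite ltn_neqAle count_size andbT -all_count.
Qed.

Lemma iter_round_good N L t : size L <= N ->
  t \in iter N round L -> good (iter N round L) t.
Proof.
move=> LN; case: (iter_round N L) => [/allP H /H //|H].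
have : size (iter N round L) = 0 by lia.
by move/size0nil => ->.
Qed.

Lemma iter_round_sub N L t : t \in iter N round L -> t \in L.
Proof.
elim: N => //= N IH; rewrite /round mem_rev mem_filter => /andP [_]; exact: IH.
Qed.

End Elimination.

Lemma conflict_inP c u t : reflect
  (exists2 j, j < size t & conflict c u (nth (SyProp, (false, false)) t j) (drop j.+1 t))
  (conflict_in c u t).
Proof.
elim: t => [|d v IH] /=; first by constructor; case.
case: (boolP (conflict c u d v)) => /= H; first by constructor; exists 0; rewrite ?drop0.
apply: (iffP IH) => [[j jl Hj]|[[|j] jl Hj]]; first by exists j.+1.
- by rewrite /= drop0 (negbTE H) in Hj.
- by exists j.
Qed.

Lemma conflictsP t0 t : reflect
  (exists2 i, i < size t & conflict_in (nth (SyProp, (false, false)) t i) (drop i.+1 t) t0)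
  (conflicts t0 t).
Proof.
elim: t => [|c u IH] /=; first by constructor; case.
case: (boolP (conflict_in c u t0)) => /= H; first by constructor; exists 0; rewrite ?drop0.
apply: (iffP IH) => [[j jl Hj]|[[|j] jl Hj]]; first by exists j.+1.
- by rewrite /= drop0 (negbTE H) in Hj.
- by exists j.
Qed.

Definition bits_at (t : seq asym) (j : nat) : bits := (nth (SyProp, (false, false)) t j).2.

Lemma no_conflictsP w t : map fst t = w -> reflect
  (forall i j, i < size w -> j < size w -> nth SyProp w i = SyProp -> nth SyProp w j = SyProp ->
     bit_prefix (drop i.+1 w) = bit_prefix (drop j.+1 w) -> (bits_at t i).2 = (bits_at t j).2)
  (~~ conflicts t t).
Proof.
move=> tw; have sz : size t = size w by rewrite -tw size_map.
have nw i : i < size w -> (nth (SyProp, (false, false)) t i).1 = nth SyProp w i.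
  by move=> iw; rewrite -tw (nth_map (SyProp, (false, false))) ?sz.
apply: (iffP negP) => H.
- move=> i j iw jw ci cj pij; apply/eqP; apply: contraT => ne; case: H.
  apply/conflictsP; exists i; rewrite ?sz //; apply/conflict_inP; exists j; rewrite ?sz //.
  by rewrite /conflict !nw // ci cj !eqxx ne !map_drop tw pij eqxx.
- move=> /conflictsP [i iw /conflict_inP [j jw]]; rewrite sz in iw jw.
  rewrite /conflict !nw // !map_drop tw => /and4P [/eqP ci /eqP cj /eqP dij /eqP pij].
  by apply: dij; apply: H.
Qed.

(** * What the scan computes on the encoding of a formula *)

Section Formulas.
Variables (Pi : Type) (name : Pi -> seq bool).

Notation enc := (enc name).
Notation enc_prop := (enc_prop name).
Notation form := (Defs.form Pi).

Definition len (phi : form) : nat := size (enc phi).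

(* [node o phi i psi]: when [phi] is written at position [o], its subformula
   occurrence [psi] is written at position [i]. *)
Fixpoint node (o : nat) (phi : form) (i : nat) (psi : form) : Prop :=
  (i = o /\ psi = phi) \/
  match phi with
  | And a b | Or a b => node o.+1 a i psi \/ node (o.+1 + len a) b i psi
  | Box a | Dia a => node o.+1 a i psi
  | _ => False
  end.

Fixpoint all_nodes (N : nat -> form -> bool) (o : nat) (phi : form) : bool :=
  N o phi &&
  match phi with
  | And a b | Or a b => all_nodes N o.+1 a && all_nodes N (o.+1 + len a) b
  | Box a | Dia a => all_nodes N o.+1 a
  | _ => true
  end.

Lemma all_nodesP (N : nat -> form -> bool) o phi :
  reflect (forall i psi, node o phi i psi -> N i psi) (all_nodes N o phi).
Proof.
elim: phi o => [p|p|a IHa b IHb|a IHa b IHb|k ps qs|a IHa|a IHa] o /=; rewrite ?andbT.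
1,2,5: by apply: (iffP idP) => [H i psi [[-> ->]|]|H] //; apply: H; left.
3,4: by apply: (iffP andP) => [[H /IHa Ha] i psi [[-> ->]|/Ha]|H] //;
  split; [apply: H; left | apply/IHa => i psi ?; apply: H; right].
all: by apply: (iffP and3P) => [[H /IHa Ha /IHb Hb] i psi [[-> ->]|[/Ha|/Hb]]|H] //;
  split; [apply: H; left | apply/IHa => i psi ?; apply: H; right; left
         | apply/IHb => i psi ?; apply: H; right; right].
Qed.

Fixpoint prop_positions (o : nat) (ps : seq Pi) : seq nat :=
  if ps is p :: ps' then o :: prop_positions (o + size (enc_prop p)) ps' else [::].

Definition enc_props (ps : seq Pi) : seq sym := flatten (map enc_prop ps).

Section Comparison.
Variables (bt bt' : nat -> bits) (k : nat -> bool) (fwd : bool).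

Let m i := (bt i).1.
Let v i := (bt i).2.
Let m' i := (bt' i).1.
Let v' i := (bt' i).2.

Definition incl_match i (ps qs : seq Pi) : bool :=
  all2 (fun a b => v a == v' b) (prop_positions i.+1 ps)
    (prop_positions (i.+2 + size (enc_props ps)) qs).

(** The scan applies the rule [m ==> v] to every [SyProp], whatever its context. Hence it also
    appears for the symbols inside negated literals and inclusion atoms, whose own team bit carries
    no meaning. *)
Definition node_local i (psi : form) : bool :=
  match psi with
  | Pos _ => m i ==> v i
  | Neg _ => (m i.+1 ==> v i.+1) && (m i ==> ~~ v i.+1)
  | And a b => (m i == m i.+1) && (m i == m (i.+1 + len a))
  | Or a b => m i == m i.+1 || m (i.+1 + len a)
  | Incl _ ps qs => all (fun j => m j ==> v j)
      (prop_positions i.+1 ps ++ prop_positions (i.+2 + size (enc_props ps)) qs)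
  | _ => true
  end.

Definition node_edge i (psi : form) : bool :=
  if psi is Box _ then if fwd then m i ==> m' i.+1 else m' i ==> m i.+1 else true.

Definition node_demand i (psi : form) : bool :=
  match psi with
  | Box _ => k i ==> fwd || (m i.+1 ==> m' i)
  | Dia _ => k i ==> if fwd then m i ==> m' i.+1 else m i.+1 ==> m' i
  | Incl _ ps qs => k i ==> fwd ==> (m i ==> m' i && incl_match i ps qs)
  | _ => true
  end.

(** Negation of what the flag [ne] accumulates. Inclusion atoms fall under the default case, as
    companions need no edge. *)
Definition node_no_edge i (psi : form) : bool :=
  match psi with
  | Box _ => ~~ [&& k i, ~~ fwd & m i.+1]
  | Dia _ => ~~ (k i && if fwd then m i else m i.+1)
  | _ => true
  end.

Fixpoint cols (o : nat) (w : seq sym) : seq (sym * bits * bits * bool) :=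
  if w is c :: w' then (c, bt o, bt' o, k o) :: cols o.+1 w' else [::].

Lemma cols_cat o w1 w2 : cols o (w1 ++ w2) = cols o w1 ++ cols (o + size w1) w2.
Proof. by elim: w1 o => [|c w1 IH] o /=; rewrite ?addn0 // IH addnS. Qed.

Lemma nth_cols z0 o w j : j < size w ->
  nth z0 (cols o w) j = (nth SyProp w j, bt (o + j), bt' (o + j), k (o + j)).
Proof.
by elim: w o j => // c w IH o [|j] /= jw; rewrite ?addn0 // IH // addnS.
Qed.

Lemma size_cols o w : size (cols o w) = size w.
Proof. by elim: w o => //= c w IH o; rewrite IH. Qed.

(** Here [L] is the whole stack of parsed items, including the one kept in [top]. *)
Definition St ok ed pm nm rs ne mt (L P : seq item) : reg * seq item * seq item :=
  (Reg ok ed pm nm rs ne (ohead L) mt, behead L, P).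

Notation run := (foldr (scan_col fwd)).

Lemma run_bits ok ed pm nm rs ne mt L P o s :
  run (St ok ed pm nm rs ne mt L P) (cols o (map SyBit s)) =
  St ok ed pm (nm || (s != [::])) rs ne mt L P.
Proof. by elim: s o => [|b s IH] o /=; rewrite ?orbF // IH /St /= orbT. Qed.

Lemma ocons_ohead T (L : seq T) : ocons (ohead L) (behead L) = L.
Proof. by case: L. Qed.

Lemma run_prop ok ed pm nm rs ne mt L P o p :
  run (St ok ed pm nm rs ne mt L P) (cols o (enc_prop p)) =
  let x := (true, (bt o, bt' o)) in
  St (ok && (m o ==> v o)) ed pm false rs ne mt
     (if pm then L else x :: L) (if pm then x :: P else P).
Proof.
rewrite /= run_bits /m /v /St /scan_col /=.
by case: pm => //=; rewrite ocons_ohead.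
Qed.

Lemma run_props ok ed pm rs ne mt L P o ps :
  run (St ok ed pm false rs ne mt L P) (cols o (enc_props ps)) =
  let xs := [seq (true, (bt j, bt' j)) | j <- prop_positions o ps] in
  St (ok && all (fun j => m j ==> v j) (prop_positions o ps)) ed pm false rs ne mt
     (if pm then L else xs ++ L) (if pm then xs ++ P else P).
Proof.
elim: ps o => [|p ps IH] o; first by rewrite /= andbT; case: pm.
have E : enc_props (p :: ps) = enc_prop p ++ enc_props ps by [].
rewrite E cols_cat foldr_cat IH run_prop /=.
by case: pm {IH} => /=; congr St; btauto.
Qed.

Lemma run_cmp ok ed pm nm rs ne mt L xs ys :
  size xs = size ys ->
  foldl cmp_step (St ok ed pm nm rs ne mt ([seq (true, (bt j, bt' j)) | j <- ys] ++ L) [::]).1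
    [seq (true, (bt i, bt' i)) | i <- xs] =
  (St ok ed pm nm rs ne
     (if xs is [::] then mt else Some (odflt true mt && all2 (fun i j => v i == v' j) xs ys))
     L [::]).1.
Proof.
elim: xs ys mt => [|i xs IH] [|j ys] mt //= [sz].
rewrite [cmp_step _ _](_ : _ = (St ok ed pm nm rs ne
  (Some (odflt true mt && (v i == v' j)))
  ([seq (true, (bt j, bt' j)) | j <- ys] ++ L) [::]).1); last first.
  by rewrite /cmp_step /St /= /v /v'; case: (bt' j).
by rewrite IH // andbA; case: xs ys sz {IH} => [|? ?] [|? ?] //= _; rewrite andbT.
Qed.

Definition is_pos (phi : form) : bool := if phi is Pos _ then true else false.

Lemma size_prop_positions o ps : size (prop_positions o ps) = size ps.
Proof. by elim: ps o => //= p ps IH o; rewrite IH. Qed.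

(** Flags and stack are arbitrary at the start because the second argument of a binary operator is
    scanned before the first: the induction hypothesis for the first argument is used in the state
    that the second one leaves. *)
Lemma run_form phi ok ed rs ne L o :
  run (St ok ed false false rs ne None L [::]) (cols o (enc phi)) =
  St (ok && all_nodes node_local o phi) (ed && all_nodes node_edge o phi) false false
     (rs && all_nodes node_demand o phi) (ne || ~~ all_nodes node_no_edge o phi) None
     ((is_pos phi, (bt o, bt' o)) :: L) [::].
Proof.
elim: phi ok ed rs ne L o => [p|p|a IHa b IHb|a IHa b IHb|n ps qs|a IHa|a IHa] ok ed rs ne L o.
- by rewrite run_prop /=; congr St; btauto.
- have -> : enc (Neg p) = [:: SyNeg] ++ enc_prop p by [].
  rewrite cols_cat foldr_cat run_prop /= addn1.
  rewrite /St /scan_col /= /m /v.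
  case: (bt o.+1) => m1 v1; case: (bt' o.+1) => m1' v1' /=.
  by congr (Reg _ _ _ _ _ _ _ _, _, _); btauto.
- have -> : enc (And a b) = [:: SyAnd] ++ (enc a ++ enc b) by [].
  rewrite !cols_cat !foldr_cat.
  rewrite IHb IHa /= !addn1 -/(len a) /St /scan_col /= /m.
  case: (bt o.+1) => m1 v1; case: (bt (o.+1 + len a)) => m2 v2 /=.
  by congr (Reg _ _ _ _ _ _ _ _, _, _); rewrite ?negb_and; btauto.
- have -> : enc (Or a b) = [:: SyOr] ++ (enc a ++ enc b) by [].
  rewrite !cols_cat !foldr_cat.
  rewrite IHb IHa /= !addn1 -/(len a) /St /scan_col /= /m.
  case: (bt o.+1) => m1 v1; case: (bt (o.+1 + len a)) => m2 v2 /=.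
  by congr (Reg _ _ _ _ _ _ _ _, _, _); rewrite ?negb_and; btauto.
- have -> : enc (Incl ps qs) = [:: SyIncl] ++ (enc_props ps ++ [:: SySub] ++ enc_props qs) by [].
  rewrite !cols_cat !foldr_cat run_props /= !addn1 -addSn.
  rewrite [X in run X _](_ : _ = St
     (ok && all (fun j => m j ==> v j) (prop_positions (o.+2 + size (enc_props ps)) qs))
     ed true false rs ne None
     ([seq (true, (bt j, bt' j)) | j <- prop_positions (o.+2 + size (enc_props ps)) qs] ++ L)
     [::]); last by rewrite /St /scan_col /=; congr (Reg _ _ _ _ _ _ _ _, _, _); btauto.
  rewrite run_props /= cats0 /scan_col /=.
  rewrite [foldl _ _ _]run_cmp ?size_prop_positions ?size_tuple //.
  rewrite /St /= all_cat /incl_match.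
  have : size (prop_positions o.+1 ps) = n.+1 by rewrite size_prop_positions size_tuple.
  (* The left-hand side has [n.+1] symbols, so the comparison has set [mt] when [SyIncl] asks for
     it. *)
  move=> sz; have E T (x y : T) : (if prop_positions o.+1 ps is [::] then x else y) = y.
    by case: (prop_positions _ _) sz.
  rewrite E /= ocons_ohead /m' /m.
  by congr (Reg _ _ _ _ _ _ _ _, _, _); btauto.
- have -> : enc (Box a) = [:: SyBox] ++ enc a by [].
  rewrite cols_cat foldr_cat IHa /= addn1.
  rewrite /St /scan_col /= /m /m'.
  case: (bt o.+1) => m1 v1; case: (bt' o.+1) => m1' v1' /=.
  by congr (Reg _ _ _ _ _ _ _ _, _, _); rewrite ?negb_and ?negbK; btauto.
- have -> : enc (Dia a) = [:: SyDia] ++ enc a by [].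
  rewrite cols_cat foldr_cat IHa /= addn1.
  rewrite /St /scan_col /= /m /m'.
  case: (bt o.+1) => m1 v1; case: (bt' o.+1) => m1' v1' /=.
  by congr (Reg _ _ _ _ _ _ _ _, _, _); rewrite ?negb_and ?negbK; btauto.
Qed.

End Comparison.
End Formulas.

(** * Parsing *)

Section Parsing.
Variables (Pi : Type) (name : Pi -> seq bool).

Notation enc := (enc name).
Notation enc_prop := (enc_prop name).
Notation enc_props := (enc_props name).
Notation form := (Defs.form Pi).
Notation run fwd := (foldr (scan_col fwd)).

Lemma scan_foldl fwd t t' K st :
  scan fwd t t' K st = foldl (fun st z => scan_col fwd z st) st
    [seq (nth SyProp (map fst t) j, bits_at t j, bits_at t' j, nth false K j)
      | j <- iota 0 (size t)].
Proof.
elim: t t' K st => [|[c b] t IH] t' K st //=.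
rewrite {}IH -[1]/(1 + 0) iotaDl -map_comp /bits_at.
have -> : head false K = nth false K 0 by case: K.
have -> : (head (SyProp, (false, false)) t') = nth (SyProp, (false, false)) t' 0 by case: t'.
congr foldl; apply: eq_map => j /=.
by case: t' => [|? ?]; case: K => *; rewrite /= ?nth_nil.
Qed.

(** Scanning the reversed words is a right fold over the columns in their original order. The marker
    is not reversed, which explains the index [(size w).-1 - j]. *)
Lemma scan_cols fwd t t' K st w : map fst t = w -> map fst t' = w ->
  scan fwd (rev t) (rev t') K st =
  run fwd st (cols (bits_at t) (bits_at t') (fun j => nth false K ((size w).-1 - j)) 0 w).
Proof.
move=> tw tw'; have sz : size t = size w by rewrite -tw size_map.
have sz' : size t' = size w by rewrite -tw' size_map.
rewrite scan_foldl size_rev sz; set Z := cols _ _ _ _ _.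
rewrite -[run _ _ Z](foldl_rev (fun st z => scan_col fwd z st)); congr foldl.
have sZ : size Z = size w by rewrite size_cols.
apply: (@eq_from_nth _ (SyProp, (false, false), (false, false), false)).
  by rewrite size_map size_iota size_rev.
move=> j; rewrite size_map size_iota => jw.
rewrite (nth_map 0) ?size_iota // nth_iota // add0n nth_rev ?sZ // nth_cols; last by lia.
rewrite map_rev tw nth_rev // add0n /bits_at !nth_rev ?sz ?sz' //.
by congr (_, _, _, _); congr (nth _ _); lia.
Qed.

Lemma accept_form fwd bt bt' k phi :
  accepting_state (run fwd (reg0, [::], [::]) (cols bt bt' k 0 (enc phi))) =
  [&& all_nodes name (node_local name bt) 0 phi,
      all_nodes name (node_demand name bt bt' k fwd) 0 phi &
      all_nodes name (node_no_edge bt k fwd) 0 phi ||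
      all_nodes name (node_edge bt bt' fwd) 0 phi].
Proof.
have := run_form name bt bt' k fwd phi true true true false [::] 0.
rewrite /St /= => ->; rewrite /accepting_state /accepting /=.
by rewrite implybE negbK.
Qed.

Lemma pass_form fwd K t t' phi : map fst t = enc phi -> map fst t' = enc phi ->
  let k j := nth false K ((len name phi).-1 - j) in
  pass fwd K t t' =
  [&& all_nodes name (node_local name (bits_at t)) 0 phi,
      all_nodes name (node_demand name (bits_at t) (bits_at t') k fwd) 0 phi &
      all_nodes name (node_no_edge (bits_at t) k fwd) 0 phi ||
      all_nodes name (node_edge (bits_at t) (bits_at t') fwd) 0 phi].
Proof.
by move=> tw tw' k; rewrite /pass (scan_cols _ _ _ tw tw') accept_form.
Qed.

Fixpoint items_of (L : seq item) (fs : seq form) : Prop :=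
  match L, fs with
  | [::], [::] => True
  | x :: L', f :: fs' => (x.1 -> exists p, f = Pos p) /\ items_of L' fs'
  | _, _ => False
  end.

Definition encs (fs : seq form) : seq sym := flatten (map enc fs).

Lemma cmp_ok P r F : ok (foldl cmp_step (r, F) P).1 -> ok r.
Proof.
elim: P r F => [|p P IH] r F //= /IH.
by case: r => [o e pm nm rs ne [[[] [? [? ?]]]|] mt].
Qed.

(** The encoding does not mark where the right-hand side of an inclusion atom ends. It consists of
    as many items as [P] has, and [ok] survives only if all of them are proposition symbols; the
    rest of the stack belongs to later formulas. *)
Lemma cmp_parse P L fs r : top r = ohead L -> items_of L fs ->
  ok (foldl cmp_step (r, behead L) P).1 ->
  exists qs L' fs' mt', [/\ fs = map (@Pos Pi) qs ++ fs', size qs = size P, items_of L' fs',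
    foldl cmp_step (r, behead L) P =
      (Reg (ok r) (ed r) (pm r) (nm r) (rs r) (ne r) (ohead L') mt', behead L') &
    P = [::] -> mt' = mt r].
Proof.
elim: P L fs r => [|p P IH] L fs r tr Lfs; rewrite /=.
  by move=> _; exists [::], L, fs, (mt r); split=> //; case: r tr => ? ? ? ? ? ? ? ? /= ->.
have bad e pm nm rs ne tp mt l :
    ~~ ok (foldl cmp_step (Reg false e pm nm rs ne tp mt, l) P).1.
  elim: (P) tp mt l {IH} => [|p' P' IH] //= tp mt l.
  by rewrite {2}/cmp_step /=; case: tp => [[[] [? [? ?]]]|]; apply: IH.
case: r tr => o e pm nm rs ne tp mt /= tr; rewrite {2 4}/cmp_step /=.
case: L Lfs tr => [|[b [bb [m' v']]] L]; rewrite /= => Lfs ->; first by rewrite (negbTE (bad _ _ _ _ _ _ _ _)).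
case: b Lfs => Lfs; last by rewrite (negbTE (bad _ _ _ _ _ _ _ _)).
case: fs Lfs => //= f fs [/(_ isT) [q ->] Lfs] okP.
have [|qs [L' [fs' [mt' [-> sq Lfs' -> _]]]]] := IH L fs _ _ Lfs okP; first by [].
by exists (q :: qs), L', fs', mt'; split=> //=; rewrite sq.
Qed.

(** Invariant for the suffix already scanned: the bits [bs] of an unfinished name, the part [ps] of
    an unfinished left-hand side together with its [SySub], and the finished formulas [fs]. *)
Definition parsed (w : seq sym) (st : reg * seq item * seq item) : Prop :=
  let: (r, F, P) := st in
  exists L bs ps fs, [/\
    [/\ top r = ohead L, F = behead L & items_of L fs],
    w = map SyBit bs ++ (if pm r then enc_props ps ++ [:: SySub] else [::]) ++ encs fs,
    nm r = (bs != [::]), mt r = None & if pm r then size P = size ps else P = [::]].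

Hypothesis name_bij : bijective name.

(** Converse of the analysis of encodings: an error-free scan reconstructs the formulas.
    Surjectivity of [name] enters because any bit string after [SyProp] must be the name of some
    symbol. *)
Lemma parse fwd bt bt' k w o :
  ok (run fwd (reg0, [::], [::]) (cols bt bt' k o w)).1.1 ->
  parsed w (run fwd (reg0, [::], [::]) (cols bt bt' k o w)).
Proof.
have [inv nameK invK] := name_bij.
elim: w o => [|c w IH] o /=; first by exists [::], [::], [::], [::].
move: (IH o.+1); case: (foldr _ _ _) => [[r F] P] {}IH /=.
have {}IH : ok r -> parsed w (r, F, P) by [].
rewrite /scan_col.
have nn (bs : seq bool) : ~~ (bs != [::]) -> bs = [::] by case: bs.
case: c => [b||||||||].
- case: r IH => o1 e pm nm rs ne tp mt IH /= /IH [L [bs [ps [fs [/= [-> -> Lfs] -> _ -> HP]]]]].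
  by exists L, (b :: bs), ps, fs.
- case: r IH => o1 e pm nm rs ne tp mt IH /= /andP [/IH + _].
  move=> [L [bs [ps [fs [/= [-> -> Lfs] -> _ -> HP]]]]] {IH}.
  case: pm HP => HP.
  + exists L, [::], (inv bs :: ps), fs; split=> //=; last by rewrite HP.
    by rewrite /enc_props /= /Defs.enc_prop invK !catA.
  + exists ((true, (bt o, bt' o)) :: L), [::], [::], (Pos (inv bs) :: fs); split=> //=.
      split=> //; last by split=> // _; exists (inv bs).
      by case: (L).
    by rewrite /encs /= /Defs.enc_prop invK.
- case: r IH => o1 e pm nm rs ne [[[] [[m1 v1] b']]|] mt IH //=.
  move=> /andP [/and3P [/IH + nmF pmF] _].
  move=> [[|x L] [bs [ps [fs [/= [// [<-] -> Lfs] -> nmE -> HP]]]]] {IH}.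
  rewrite nmE in nmF *; rewrite (nn _ nmF) (negbTE pmF) /= in HP *.
  case: fs Lfs => //= f fs [/(_ isT) [q ->] Lfs].
  by exists ((false, (bt o, bt' o)) :: L), [::], [::], (Neg q :: fs); split=> //=; split => //; case: (L).
- case: r IH => o1 e pm nm rs ne [[? [[m1 v1] ?]]|] mt IH //=.
  case: F IH => [|[? [[m2 v2] ?]] F] IH //= /andP [/and3P [/IH + nmF pmF] _].
  move=> [[|x [|y L]] [bs [ps [fs [/= [// [_] // [_ ->] Lfs] -> nmE -> HP]]]]] {IH}.
  rewrite nmE in nmF *; rewrite (nn _ nmF) (negbTE pmF) /= in HP *.
  case: fs Lfs => [|f1 [|f2 fs]] //= [] // _ [_ Lfs].
  exists ((false, (bt o, bt' o)) :: L), [::], [::], (And f1 f2 :: fs); split=> //=.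
  by rewrite /encs /= !catA.
- case: r IH => o1 e pm nm rs ne [[? [[m1 v1] ?]]|] mt IH //=.
  case: F IH => [|[? [[m2 v2] ?]] F] IH //= /andP [/and3P [/IH + nmF pmF] _].
  move=> [[|x [|y L]] [bs [ps [fs [/= [// [_] // [_ ->] Lfs] -> nmE -> HP]]]]] {IH}.
  rewrite nmE in nmF *; rewrite (nn _ nmF) (negbTE pmF) /= in HP *.
  case: fs Lfs => [|f1 [|f2 fs]] //= [] // _ [_ Lfs].
  exists ((false, (bt o, bt' o)) :: L), [::], [::], (Or f1 f2 :: fs); split=> //=.
  by rewrite /encs /= !catA.
- rewrite /=; case E : (foldl cmp_step (r, F) P) => [r1 F1] /=.
  case: r1 E => o1 e pm' nm' rs ne tp mt' E /= /and4P [o1T nmF pmT mtT].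
  have okr : ok r by have := @cmp_ok P r F; rewrite E /=; apply.
  have [L [bs [ps [fs [/= [Lt FE Lfs] -> nmE mtE HP]]]]] := IH okr.
  have [|qs [L' [fs' [mt2 [fsE sq Lfs' E2 mtP]]]]] := cmp_parse Lt Lfs (P := P).
    by rewrite -FE E.
  rewrite -FE E in E2; case: E2 => _ _ pmE nm'E _ _ tpE mt2E F1E.
  rewrite -pmE pmT in HP *; rewrite -nm'E in nmE.
  rewrite nmE in nmF *; rewrite (nn _ nmF) /=.
  (* [mt] is set only by a comparison, so requiring it at [SyIncl] excludes inclusion atoms of arity
     zero. *)
  have PN : P <> [::] by move=> P0; rewrite mt2E (mtP P0) mtE in mtT.
  case: P PN sq HP {mtP IH E} => // p0 P _ sq HP.
  have sps : size ps == (size P).+1 by rewrite -HP.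
  have sqs : size qs == (size P).+1 by rewrite sq.
  exists ((false, (bt o, bt' o)) :: L'), [::], [::], (Incl (Tuple sps) (Tuple sqs) :: fs').
  rewrite tpE F1E; split=> //=; first by split=> //; case: (L').
  rewrite fsE /encs /= map_cat flatten_cat -map_comp -catA /=; congr (_ :: _).
  by rewrite -catA.
- case: r IH => o1 e pm nm rs ne tp mt IH /= /and3P [/IH + nmF pmF].
  move=> [L [bs [ps [fs [/= [-> -> Lfs] -> nmE -> HP]]]]] {IH}.
  rewrite nmE in nmF *; rewrite (nn _ nmF) (negbTE pmF) /= in HP *.
  by exists L, [::], [::], fs; split=> //=; rewrite ?HP ?(nn _ nmF).
- case: r IH => o1 e pm nm rs ne [[? [[m1 v1] [m1' v1']]]|] mt IH //=.
  move=> /and3P [/IH + nmF pmF].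
  move=> [[|x L] [bs [ps [fs [/= [// [_] -> Lfs] -> nmE -> HP]]]]] {IH}.
  rewrite nmE in nmF *; rewrite (nn _ nmF) (negbTE pmF) /= in HP *.
  case: fs Lfs => //= f fs [_ Lfs].
  by exists ((false, (bt o, bt' o)) :: L), [::], [::], (Box f :: fs); split=> //=; split => //; case: (L).
- case: r IH => o1 e pm nm rs ne [[? [[m1 v1] [m1' v1']]]|] mt IH //=.
  move=> /and3P [/IH + nmF pmF].
  move=> [[|x L] [bs [ps [fs [/= [// [_] -> Lfs] -> nmE -> HP]]]]] {IH}.
  rewrite nmE in nmF *; rewrite (nn _ nmF) (negbTE pmF) /= in HP *.
  case: fs Lfs => //= f fs [_ Lfs].
  by exists ((false, (bt o, bt' o)) :: L), [::], [::], (Dia f :: fs); split=> //=; split => //; case: (L).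
Qed.

Lemma pass_parse fwd K t t' : map fst t = map fst t' -> pass fwd K t t' ->
  exists phi, map fst t = enc phi.
Proof.
move=> tt'; rewrite /pass (scan_cols _ _ _ (erefl _) (esym tt')).
move: (@parse fwd (bits_at t) (bits_at t')
  (fun j => nth false K ((size (map fst t)).-1 - j)) (map fst t) 0).
case: (foldr _ _ _) => [[r F] P] H; rewrite /accepting_state /accepting /=.
move=> /and5P [okr pmF nmF tpT /and3P [FN _ _]].
have {H} := H okr; case=> L [bs [ps [fs [[/= Lt FE Lfs] -> nmE _ HP]]]].
rewrite nmE negbK in nmF; rewrite (eqP nmF) (negbTE pmF) /=.
case: L Lt FE Lfs => [|x [|y L]] Lt FE Lfs; rewrite ?Lt ?FE // in tpT FN.
by case: fs Lfs => [|f [|? ?]] //= [_ []]; exists f; rewrite /encs /= cats0.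
Qed.

End Parsing.

(** * Surviving words and satisfiability *)

Section Satisfiability.
Variables (Pi : Type) (name : Pi -> seq bool).
Hypothesis name_bij : bijective name.

Notation enc := (enc name).
Notation enc_prop := (enc_prop name).
Notation enc_props := (enc_props name).
Notation len := (len name).
Notation node := (node name).
Notation form := (Defs.form Pi).

Local Open Scope classical_set_scope.

Lemma bit_prefix_map s r : bit_prefix r = [::] -> bit_prefix (map SyBit s ++ r) = s.
Proof. by move=> r0; elim: s => //= b s ->. Qed.

Lemma bit_prefix_enc phi r : bit_prefix (enc phi ++ r) = [::].
Proof. by case: phi. Qed.

Lemma len_gt0 phi : 0 < len phi.
Proof. by case: phi. Qed.

(** That no bit follows makes the name read after position [j] exactly that of [p], not an extension
    of it. *)
Definition written (w : seq sym) (j : nat) (p : Pi) : Prop :=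
  exists l r, [/\ w = l ++ enc_prop p ++ r, size l = j & bit_prefix r = [::]].

Lemma writtenE w j p : written w j p ->
  [/\ j < size w, nth SyProp w j = SyProp & bit_prefix (drop j.+1 w) = name p].
Proof.
case=> l [r [-> <- r0]]; rewrite !size_cat /= nth_cat ltnn subnn; split=> //; first lia.
have -> : l ++ SyProp :: map SyBit (name p) ++ r = rcons l SyProp ++ map SyBit (name p) ++ r.
  by rewrite cat_rcons.
by rewrite drop_cat size_rcons ltnn subnn drop0 bit_prefix_map.
Qed.

Lemma written_props w l ps r p0 : w = l ++ enc_props ps ++ r -> bit_prefix r = [::] ->
  forall x, x < size ps -> written w (nth 0 (prop_positions name (size l) ps) x) (nth p0 ps x).
Proof.
move=> + r0; elim: ps l => [|p ps IH] l wE [|x] //= xps.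
- exists l, (enc_props ps ++ r); split=> //; first by rewrite wE /enc_props /= -!catA.
  by case: (ps).
- have -> : size l + (size [seq SyBit i | i <- name p]).+1 = size (l ++ enc_prop p).
    by rewrite size_cat.
  by apply: IH => //; rewrite wE /enc_props /= -!catA.
Qed.

Lemma incl_written w l r i k (ps qs : k.+1.-tuple Pi) :
  w = l ++ enc (Incl ps qs) ++ r -> size l = i -> bit_prefix r = [::] ->
  let p0 := thead ps in forall x, x < k.+1 ->
  written w (nth 0 (prop_positions name i.+1 ps) x) (nth p0 ps x) /\
  written w (nth 0 (prop_positions name (i.+2 + size (enc_props ps)) qs) x) (nth p0 qs x).
Proof.
move=> wE sl r0 p0 x xk.
have {}wE : w = rcons l SyIncl ++ enc_props ps ++ SySub :: enc_props qs ++ r.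
  by rewrite wE cat_rcons /= -catA.
split; first by rewrite -sl -(size_rcons l SyIncl);
  apply: (written_props _ wE) => //; rewrite size_tuple.
have -> : i.+2 + size (enc_props ps) = size ((rcons l SyIncl ++ enc_props ps) ++ [:: SySub]).
  by rewrite !size_cat size_rcons sl /=; lia.
by apply: (written_props _ _ r0); rewrite ?size_tuple // wE -!catA.
Qed.

Lemma prop_positions_range o ps j :
  j \in prop_positions name o ps -> o <= j < o + size (enc_props ps).
Proof.
elim: ps o => // p ps IH o; rewrite inE.
have -> : size (enc_props (p :: ps)) = size (enc_prop p) + size (enc_props ps).
  by rewrite -size_cat.
by case/orP => [/eqP ->|/IH] /=; lia.
Qed.

Lemma node_refl o phi : node o phi o phi.
Proof. by case: phi => *; left. Qed.

Lemma node_trans o phi i psi j chi : node o phi i psi -> node i psi j chi -> node o phi j chi.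
Proof.
elim: phi o => [p|p|a IHa b IHb|a IHa b IHb|k ps qs|a IHa|a IHa] o /=;
  case=> [[-> ->] //|]; try by [].
1,2: by case=> [/IHa H /H|/IHb H /H]; right; [left|right].
all: by move=> /IHa H /H; right.
Qed.

Lemma node_occurrence l phi r i psi : bit_prefix r = [::] -> node (size l) phi i psi ->
  exists l' r', [/\ l ++ enc phi ++ r = l' ++ enc psi ++ r', size l' = i & bit_prefix r' = [::]].
Proof.
have bin c a b l' r' : l' ++ (c :: enc a ++ enc b) ++ r' = rcons l' c ++ enc a ++ enc b ++ r'.
  by rewrite cat_rcons /= catA.
have un c a l' r' : l' ++ (c :: enc a) ++ r' = rcons l' c ++ enc a ++ r'.
  by rewrite cat_rcons.
elim: phi l r => [p|p|a IHa b IHb|a IHa b IHb|k ps qs|a IHa|a IHa] l r r0 [[-> ->]|] //;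
  do ?by exists l, r.
1,2: by case=> H; rewrite /= bin;
  [ apply: IHa; [exact: bit_prefix_enc | rewrite size_rcons]
  | rewrite catA; apply: IHb; rewrite // size_cat size_rcons].
all: by move=> H; rewrite /= un; apply: IHa; rewrite ?size_rcons.
Qed.

Lemma len_and a b : len (And a b) = (len a + len b).+1.
Proof. by rewrite /len /= size_cat. Qed.

Lemma len_or a b : len (Or a b) = (len a + len b).+1.
Proof. by rewrite /len /= size_cat. Qed.

Lemma node_range o phi i psi :
  node o phi i psi -> o <= i /\ i + len psi <= o + len phi.
Proof.
elim: phi o => [p|p|a IHa b IHb|a IHa b IHb|k ps qs|a IHa|a IHa] o /= [[-> ->]|] //.
1,2: by rewrite ?len_and ?len_or; case=> [/IHa|/IHb]; lia.
all: by move=> /IHa; rewrite /len /=; lia.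
Qed.

(** An operator occupies its own position and its arguments occupy disjoint intervals after it. *)
Lemma node_uniq o phi i psi psi' : node o phi i psi -> node o phi i psi' -> psi = psi'.
Proof.
have g0 := len_gt0 psi; have g0' := len_gt0 psi'.
elim: phi o => [p|p|a IHa b IHb|a IHa b IHb|k ps qs|a IHa|a IHa] o /=.
1,2,5: by case=> [[_ ->]|//] [[_ ->]|//].
3,4: case=> [[E ->]|Ha] [[E' ->]|Ha'] //; do ?exact: IHa Ha Ha'.
1,2: case=> [[E ->]|[Ha|Ha]] [[E' ->]|[Ha'|Ha']] //; do ?[exact: IHa Ha Ha'|exact: IHb Ha Ha'].
all: try by have [] := node_range Ha'; try (have [] := node_range Ha); lia.
all: by have [] := node_range Ha; lia.
Qed.

Lemma all2_nth T1 T2 (r : T1 -> T2 -> bool) x1 x2 s1 s2 : size s1 = size s2 ->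
  all2 r s1 s2 <-> (forall j, j < size s1 -> r (nth x1 s1 j) (nth x2 s2 j)).
Proof.
elim: s1 s2 => [|y1 s1 IH] [|y2 s2] //= [sz]; split.
- by move=> /andP [r1 /(IH _ sz) H] [|j] //= jl; apply: H.
- by move=> H; rewrite (H 0) //=; apply/(IH _ sz) => j jl; apply: (H j.+1).
Qed.

(** * A stable list of words is a finite model *)

Section Soundness.
Variables (phi : form) (L : seq (seq asym)).
Hypothesis L_enc : forall t, t \in L -> map fst t = enc phi.
Hypothesis L_good : forall t, t \in L -> good L t.

Let w := enc phi.

Lemma stable_pass t i fwd : t \in L -> i < len phi ->
  exists2 t', t' \in L & pass fwd (marker i) t t'.
Proof.
move=> tL il; have /andP [_ /allP H] := L_good tL.
have /H : i \in iota 0 (size t).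
  by rewrite mem_iota -(size_map fst) L_enc.
by case/andP => /hasP [t1 ? ?] /hasP [t2 ? ?]; case: fwd; [exists t1|exists t2].
Qed.

Definition stable_access (t t' : seq_sub L) : Prop :=
  forall i psi, node 0 phi i psi -> node_edge (bits_at (ssval t)) (bits_at (ssval t')) true i psi.

Lemma node_edge_rev bt bt' i (psi : form) :
  node_edge bt bt' false i psi = node_edge bt' bt true i psi.
Proof. by []. Qed.

Lemma stable_local t : t \in L ->
  forall i psi, node 0 phi i psi -> node_local name (bits_at t) i psi.
Proof.
move=> tL; have [t' t'L] := @stable_pass t 0 true tL (len_gt0 _).
by rewrite (pass_form _ _ (L_enc tL) (L_enc t'L)) => /and3P [/all_nodesP].
Qed.

Lemma stable_demand (t : seq_sub L) fwd i psi : node 0 phi i psi ->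
  exists t' : seq_sub L,
    node_demand name (bits_at (ssval t)) (bits_at (ssval t')) (fun=> true) fwd i psi /\
    (node_no_edge (bits_at (ssval t)) (fun=> true) fwd i psi \/
     if fwd then stable_access t t' else stable_access t' t).
Proof.
move=> Hi; have il : i < len phi by have := node_range Hi; have := len_gt0 psi; lia.
(* Markers count positions from the right, occurrences from the left. *)
have [|t' t'L] := @stable_pass (ssval t) ((len phi).-1 - i) fwd (ssvalP t); first lia.
rewrite (pass_form _ _ (L_enc (ssvalP t)) (L_enc t'L)).
set k := fun j => nth false _ _ => /and3P [_ /all_nodesP D E].
have ki : k i = true by rewrite /k /marker nth_rcons size_nseq ltnn eqxx.
exists (SeqSub t'L); split.
  by move: (D _ _ Hi); case: (psi) => //=; rewrite ki.
move: E => /orP [/all_nodesP /(_ _ _ Hi)|/all_nodesP E].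
  by move=> H; left; move: H; case: (psi) => //=; rewrite ki.
by right; case: fwd D E => _ E j chi /E //; rewrite node_edge_rev.
Qed.

(** A symbol is true if one of its occurrences has the truth bit; as surviving words have no
    conflicts, every occurrence then has it. Symbols that do not occur are false everywhere. *)
Definition stable_model (t0 : seq_sub L) : kripke Pi :=
  @Kripke Pi (seq_sub L) (inhabits t0) stable_access
    (fun p => [set t | exists j, [/\ j < size w, nth SyProp w j = SyProp,
       bit_prefix (drop j.+1 w) = name p & (bits_at (ssval t) j).2]]).

Variable t0 : seq_sub L.
Notation M := (stable_model t0).

Lemma stable_valuation p j (t : M) : written w j p ->
  valuation p t <-> (bits_at (ssval t) j).2.
Proof.
move=> /writtenE [jw cj pj]; split; last by exists j.
case=> i [iw ci pi vi]; have tw := L_enc (ssvalP t).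
have /andP [/(no_conflictsP tw) H _] := L_good (ssvalP t).
by rewrite (H j i) // pi pj.
Qed.

Definition team_at (i : nat) : set M := [set t | (bits_at (ssval t) i).1].

(** A truth lemma: local conditions settle literals and Boolean connectives, while the demands
    supply the companions, predecessors and successors that the other cases ask for. *)
Lemma stable_holds psi i : node 0 phi i psi -> holds (team_at i) psi.
Proof.
elim: psi i => [p|p|a IHa b IHb|a IHa b IHb|n ps qs|a IHa|a IHa] i Hi.
all: have [//|l [r [wE sl r0]]] := @node_occurrence [::] phi [::] i _ _ Hi.
all: rewrite /= cats0 -/w in wE.
- have W : written w i p by exists l, r.
  move=> t /= mt; apply/(stable_valuation _ W).
  by have /implyP := stable_local (ssvalP t) Hi; apply.
- have W : written w i.+1 p.
    exists (rcons l SyNeg), r; split=> //; last by rewrite size_rcons sl.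
    by rewrite wE cat_rcons.
  apply/seteqP; split=> // t [/= mt /(stable_valuation _ W) vt].
  by have /andP [_] := stable_local (ssvalP t) Hi; rewrite mt vt.
- have Na : node 0 phi i.+1 a by apply: (node_trans Hi); right; left; apply: node_refl.
  have Nb : node 0 phi (i.+1 + len a) b by apply: (node_trans Hi); right; right; apply: node_refl.
  have Ea : team_at i = team_at i.+1.
    by apply: funext => t; have /andP [/eqP E _] := stable_local (ssvalP t) Hi; rewrite /team_at /= E.
  have Eb : team_at i = team_at (i.+1 + len a).
    by apply: funext => t; have /andP [_ /eqP E] := stable_local (ssvalP t) Hi; rewrite /team_at /= E.
  by split; [rewrite Ea; apply: IHa | rewrite Eb; apply: IHb].
- have Na : node 0 phi i.+1 a by apply: (node_trans Hi); right; left; apply: node_refl.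
  have Nb : node 0 phi (i.+1 + len a) b by apply: (node_trans Hi); right; right; apply: node_refl.
  have E t : team_at i t <-> team_at i.+1 t \/ team_at (i.+1 + len a) t.
    have /eqP E := stable_local (ssvalP t) Hi; rewrite /team_at /= E.
    by split=> /orP.
  exists (team_at i.+1), (team_at (i.+1 + len a)); split; [| | | exact: IHa | exact: IHb].
  + by move=> t H; apply/E; left.
  + by move=> t H; apply/E; right.
  + by apply/seteqP; split=> t; rewrite /setU /= => /E.
- pose p0 := thead ps; have W := incl_written wE sl r0.
  move=> u mu; have [v [D _]] := stable_demand u true Hi.
  move: D mu; rewrite /team_at /= => /implyP D /D /andP [mv].
  rewrite /incl_match => /(all2_nth _ 0 0); rewrite !size_prop_positions !size_tuple => /(_ erefl) H; exists v => // x.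
  rewrite !(tnth_nth p0); apply: (iff_trans (stable_valuation u (proj1 (W x (ltn_ord x))))).
  apply: iff_sym; apply: (iff_trans (stable_valuation v (proj2 (W x (ltn_ord x))))).
  by rewrite (eqP (H x (ltn_ord x))).
- have Na : node 0 phi i.+1 a by apply: (node_trans Hi); right; apply: node_refl.
  (* The condition on edges keeps successors inside the team; the backward demand gives each of its
     members a predecessor. *)
  rewrite /= (_ : succ_team _ = team_at i.+1); first exact: IHa.
  apply/seteqP; split=> t.
  + case=> s /= ms /(_ _ _ Hi) /implyP; exact.
  + move=> mt; have [s [D E]] := stable_demand t false Hi.
    move: D E; rewrite /= mt /= => ms [//|E]; by exists s.
- have Na : node 0 phi i.+1 a by apply: (node_trans Hi); right; apply: node_refl.
  (* Lax semantics admits the full set of worlds carrying the bit as witness team. *)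
  exists (team_at i.+1); last exact: IHa.
  split=> t mt.
  + have [s [D E]] := stable_demand t true Hi.
    move: D E; rewrite /= mt /= => ms [//|E]; by exists s.
  + have [s [D E]] := stable_demand t false Hi.
    move: D E; rewrite /= mt /= => ms [//|E]; by exists s.
Qed.

Lemma stable_fin_satisfiable : root_in_team (ssval t0) -> fin_satisfiable phi.
Proof.
move=> rt; exists M, (team_at 0); split.
- exact: (@finite_finset (seq_sub L)).
- by exists t0; move: rt; rewrite /team_at /= /bits_at; case: (ssval t0).
- exact: stable_holds (node_refl 0 phi).
Qed.

End Soundness.

(** * The types of the worlds of a model survive *)

Section Completeness.
Variables (M : kripke Pi).

(** Positions inside a negated literal or an inclusion atom get the empty team, which makes the
    scan's rule [m ==> v] hold there vacuously. *)
Definition team_condition (tm : nat -> set M) (i : nat) (psi : form) : Prop :=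
  match psi with
  | Pos p => tm i `<=` valuation p
  | Neg p => tm i `&` valuation p = set0 /\ tm i.+1 = set0
  | And a b => tm i.+1 = tm i /\ tm (i.+1 + len a) = tm i
  | Or a b => tm i.+1 `|` tm (i.+1 + len a) = tm i
  | Incl _ ps qs => holds (tm i) psi /\ forall j, i < j < i + len psi -> tm j = set0
  | Box a => tm i.+1 = succ_team (tm i)
  | Dia a => lax_succ (tm i) (tm i.+1)
  end.

(** The condition looks only at positions occupied by [psi], so families of teams for the arguments
    of an operator can be glued. *)
Lemma team_condition_ext tm tm' i psi :
  (forall j, i <= j < i + len psi -> tm j = tm' j) ->
  team_condition tm i psi -> team_condition tm' i psi.
Proof.
case: psi => [p|p|a b|a b|k ps qs|a|a] E /=.
- by rewrite E // leqnn -{1}[i]addn0 ltn_add2l len_gt0.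
- by rewrite !E //; rewrite /len /=; lia.
- have la := len_gt0 a; have lb := len_gt0 b.
  by rewrite !E //; rewrite len_and; lia.
- have la := len_gt0 a; have lb := len_gt0 b.
  by rewrite !E //; rewrite len_or; lia.
- rewrite E; last by rewrite leqnn -{1}[i]addn0 ltn_add2l len_gt0.
  by case=> H H'; split=> // j ij; rewrite -E; [exact: H'|lia].
- have la := len_gt0 a; have e : len (Box a) = (len a).+1 by [].
  by rewrite !E // e; lia.
- have la := len_gt0 a; have e : len (Dia a) = (len a).+1 by [].
  by rewrite !E // e; lia.
Qed.

(** Evaluation meets each occurrence with a single team, so the choices made at disjunctions and
    diamonds can be recorded as one team per position. *)
Lemma holds_teams phi (T : set M) o : holds T phi ->
  exists2 tm : nat -> set M, tm o = T &
    forall i psi, node o phi i psi -> team_condition tm i psi.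
Proof.
elim: phi T o => [p|p|a IHa b IHb|a IHa b IHb|k ps qs|a IHa|a IHa] T o /=.
- by move=> H; exists (fun=> T) => // i psi [[-> ->]|].
- move=> H; exists (fun j => if j == o then T else set0); first by rewrite eqxx.
  by move=> i psi [[-> ->]|] //=; rewrite eqxx gtn_eqF.
- case=> /(IHa _ o.+1) [ta Ea Ha] /(IHb _ (o.+1 + len a)) [tb Eb Hb].
  have la := len_gt0 a.
  have e1 : (o.+1 == o) = false by lia.
  have e2 : (o.+1 + len a == o) = false by lia.
  have e3 : o.+1 < o.+1 + len a by lia.
  exists (fun j => if j == o then T else if j < o.+1 + len a then ta j else tb j).
    by rewrite eqxx.
  move=> i psi [[-> ->]|[H|H]].
  + by rewrite /= eqxx e1 e2 e3 ltnn.
  + apply: team_condition_ext (Ha _ _ H) => j /andP [ij ji].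
    by have [oi io] := node_range H; rewrite gtn_eqF ?ifT //; lia.
  + apply: team_condition_ext (Hb _ _ H) => j /andP [ij ji].
    by have [oi io] := node_range H; rewrite gtn_eqF ?ifF //; lia.
- case=> S [S' [_ _ SS' /(IHa _ o.+1) [ta Ea Ha] /(IHb _ (o.+1 + len a)) [tb Eb Hb]]].
  have la := len_gt0 a.
  have e1 : (o.+1 == o) = false by lia.
  have e2 : (o.+1 + len a == o) = false by lia.
  have e3 : o.+1 < o.+1 + len a by lia.
  exists (fun j => if j == o then T else if j < o.+1 + len a then ta j else tb j).
    by rewrite eqxx.
  move=> i psi [[-> ->]|[H|H]].
  + by rewrite /= eqxx e1 e2 e3 ltnn Ea Eb.
  + apply: team_condition_ext (Ha _ _ H) => j /andP [ij ji].
    by have [oi io] := node_range H; rewrite gtn_eqF ?ifT //; lia.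
  + apply: team_condition_ext (Hb _ _ H) => j /andP [ij ji].
    by have [oi io] := node_range H; rewrite gtn_eqF ?ifF //; lia.
- move=> H; exists (fun j => if j == o then T else set0); first by rewrite eqxx.
  move=> i psi [[-> ->]|] //=; rewrite eqxx; split=> // j /andP [oj _].
  by rewrite gtn_eqF.
- move=> /(IHa _ o.+1) [ta Ea Ha].
  exists (fun j => if j == o then T else ta j); first by rewrite eqxx.
  move=> i psi [[-> ->]|H]; first by rewrite /= eqxx gtn_eqF.
  apply: team_condition_ext (Ha _ _ H) => j /andP [ij ji].
  by have [oi io] := node_range H; rewrite gtn_eqF //; lia.
- case=> T' TT' /(IHa _ o.+1) [ta Ea Ha].
  exists (fun j => if j == o then T else ta j); first by rewrite eqxx.
  move=> i psi [[-> ->]|H]; first by rewrite /= eqxx gtn_eqF // Ea.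
  apply: team_condition_ext (Ha _ _ H) => j /andP [ij ji].
  by have [oi io] := node_range H; rewrite gtn_eqF //; lia.
Qed.

Variables (phi : form) (tm : nat -> set M).
Hypothesis tmP : forall i psi, node 0 phi i psi -> team_condition tm i psi.

Let w := enc phi.

(** Depends on [j] only through the bits that follow it, so types are free of conflicts by
    construction. *)
Definition truth (j : nat) : set M :=
  [set u | exists2 p, name p = bit_prefix (drop j.+1 w) & valuation p u].

Definition type_of (u : M) : seq asym :=
  [seq (nth SyProp w j, (`[< tm j u >], `[< truth j u >])) | j <- iota 0 (size w)].

Lemma type_of_enc u : map fst (type_of u) = w.
Proof.
rewrite /type_of -map_comp; apply: (@eq_from_nth _ SyProp).
  by rewrite size_map size_iota.
by move=> j; rewrite size_map size_iota => jw; rewrite (nth_map 0) ?size_iota // nth_iota.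
Qed.

Lemma bits_type_of u j : j < size w -> bits_at (type_of u) j = (`[< tm j u >], `[< truth j u >]).
Proof. by move=> jw; rewrite /bits_at (nth_map 0) ?size_iota // nth_iota. Qed.

(** Injectivity of [name] is used here: the name determines the symbol. *)
Lemma truth_written p j u : written w j p -> truth j u <-> valuation p u.
Proof.
move=> /writtenE [_ _ pE]; split=> [[q + vq]|vp]; last by exists p.
by rewrite pE => /(bij_inj name_bij) <-.
Qed.

Lemma type_local u i psi : node 0 phi i psi -> node_local name (bits_at (type_of u)) i psi.
Proof.
move=> Hi; have := tmP Hi; have := node_range Hi; have := Hi.
have [//|l [r [wE sl r0]]] := @node_occurrence [::] phi [::] i psi _ Hi.
rewrite /= cats0 -/w in wE.
case: psi wE {Hi} => [p|p|a b|a b|k ps qs|a|a] wE Hi /= [_ b_i] //.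
- have W : written w i p by exists l, r.
  move=> H; rewrite bits_type_of; last by case: (writtenE W).
  by apply/implyP => /asboolP /H ?; apply/asboolP/(truth_written _ W).
- have W : written w i.+1 p.
    exists (rcons l SyNeg), r; split=> //; last by rewrite size_rcons sl.
    by rewrite wE cat_rcons.
  have [iw _ _] := writtenE W.
  case=> H H1; rewrite !bits_type_of //; last by apply: ltnW.
  rewrite /= H1; apply/andP; split; first by apply/implyP => /asboolP.
  apply/implyP => /asboolP mu; apply/asboolP => /(truth_written _ W) vu.
  by have : set0 u by rewrite -H.
- move=> [Ha Hb]; have ? := len_gt0 a; have ? := len_gt0 b; rewrite len_and in b_i.
  rewrite !bits_type_of; try by rewrite -/(len phi); lia.
  by rewrite /= Ha Hb eqxx.
- move=> H; have ? := len_gt0 a; have ? := len_gt0 b; rewrite len_or in b_i.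
  rewrite !bits_type_of; try by rewrite -/(len phi); lia.
  by rewrite /= -H -asbool_or.
- case=> _ H; apply/allP => j; rewrite mem_cat => jP.
  have lE : len (Incl ps qs) = (size (enc_props ps) + size (enc_props qs)).+2.
    by rewrite /len /= size_cat /= addnS.
  have ij : i < j < i + len (Incl ps qs).
    by case/orP: jP => /prop_positions_range; rewrite lE; lia.
  by rewrite bits_type_of /= ?H //; [apply/implyP => /asboolP|rewrite -/(len phi); lia].
Qed.

Lemma type_edge u u' i psi : access u u' -> node 0 phi i psi ->
  node_edge (bits_at (type_of u)) (bits_at (type_of u')) true i psi.
Proof.
move=> uu' Hi; have := tmP Hi; have := node_range Hi.
case: psi Hi => [p|p|a b|a b|k ps qs|a|a] Hi //= [_ b_i] H.
have la := len_gt0 a; have e : len (Box a) = (len a).+1 by [].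
rewrite !bits_type_of; try by rewrite -/(len phi); lia.
by apply/implyP => /asboolP mu; apply/asboolP; rewrite H; exists u.
Qed.

Lemma type_demand u fwd i psi : node 0 phi i psi -> exists u',
  node_demand name (bits_at (type_of u)) (bits_at (type_of u')) (fun=> true) fwd i psi /\
  (node_no_edge (bits_at (type_of u)) (fun=> true) fwd i psi \/
   if fwd then access u u' else access u' u).
Proof.
move=> Hi; have := tmP Hi; have := node_range Hi.
have [//|l [r [wE sl r0]]] := @node_occurrence [::] phi [::] i psi _ Hi.
rewrite /= cats0 -/w in wE.
case: psi wE Hi => [p|p|a b|a b|k ps qs|a|a] wE Hi /= [_ b_i] H;
  try by (exists u; split; last left).
- have iw : i < size w by have := len_gt0 (Incl ps qs); rewrite -/(len phi); lia.
  case: (pselect (tm i u)) => [/(proj1 H) [u' mu' uu']|nmu]; last first.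
    by exists u; rewrite !bits_type_of //= (asboolF nmu) implybT; split; last left.
  exists u'; split; last by left.
  rewrite !bits_type_of //= (asboolT mu') /=; apply/implyP => _; apply/implyP => _.
  apply/(all2_nth _ 0 0); rewrite !size_prop_positions !size_tuple // => x xk.
  have [W1 W2] := incl_written wE sl r0 xk.
  rewrite !bits_type_of /=; try by case: (writtenE W1); case: (writtenE W2).
  apply/eqP/asbool_equiv_eq; apply: (iff_trans (truth_written _ W1)).
  apply: iff_sym; apply: (iff_trans (truth_written _ W2)); apply: iff_sym.
  by have := uu' (Ordinal xk); rewrite !(tnth_nth (thead ps)).
- have la := len_gt0 a; have e : len (Box a) = (len a).+1 by [].
  have iw : i.+1 < size w by rewrite -/(len phi); lia.
  have iw' : i < size w by apply: ltnW.
  case: fwd; first by exists u; split; last left.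
  case: (pselect (tm i.+1 u)) => [|nmu]; last first.
    by exists u; rewrite !bits_type_of //= ?(asboolF nmu) //; split; last left.
  rewrite H => -[u' mu' au']; exists u'; split; last by right.
  by rewrite !bits_type_of //=; apply/implyP => _; apply/asboolP.
- have la := len_gt0 a; have e : len (Dia a) = (len a).+1 by [].
  have iw : i.+1 < size w by rewrite -/(len phi); lia.
  have iw' : i < size w by apply: ltnW.
  case: H => H1 H2; case: fwd.
  + case: (pselect (tm i u)) => [/H1 [u' mu' au']|nmu]; last first.
      by exists u; rewrite !bits_type_of //= (asboolF nmu); split; last left.
    exists u'; split; last by right.
    by rewrite !bits_type_of //=; apply/implyP => _; apply/asboolP.
  + case: (pselect (tm i.+1 u)) => [/H2 [u' mu' au']|nmu]; last first.
      by exists u; rewrite !bits_type_of //= (asboolF nmu); split; last left.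
    exists u'; split; last by right.
    by rewrite !bits_type_of //=; apply/implyP => _; apply/asboolP.
Qed.

Lemma type_pass u fwd x : x < size w ->
  exists u', pass fwd (marker x) (type_of u) (type_of u').
Proof.
move=> xw; pose i := (len phi).-1 - x.
have kE j : j < size w -> nth false (marker x) ((len phi).-1 - j) = (j == i).
  rewrite /marker nth_rcons size_nseq nth_nseq /i -/(len phi) => jw.
  have := xw; rewrite -/(len phi) => xw'.
  by case: ltnP => ?; [|case: eqP => ?]; symmetry; apply/eqP; lia.
have nodew j psi : node 0 phi j psi -> j < size w.
  by move=> /node_range; have := len_gt0 psi; rewrite -/(len phi); lia.
have [u' [D E]] : exists u', (forall psi, node 0 phi i psi ->
    node_demand name (bits_at (type_of u)) (bits_at (type_of u')) (fun=> true) fwd i psi) /\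
  ((forall psi, node 0 phi i psi -> node_no_edge (bits_at (type_of u)) (fun=> true) fwd i psi) \/
   if fwd then access u u' else access u' u).
  (* The marked position may start no subformula occurrence (a bit, [SySub], a symbol inside an
     atom). Then there is no demand and [u] itself serves. *)
  case: (pselect (exists psi, node 0 phi i psi)) => [[psi Hi]|Hi]; last first.
    by exists u; split; [|left] => psi Hpsi; case: Hi; exists psi.
  have [u' [D E]] := type_demand u fwd Hi; exists u'; split.
    by move=> psi' Hi'; rewrite -(node_uniq Hi Hi').
  by case: E; [left => psi' Hi'; rewrite -(node_uniq Hi Hi')|right].
exists u'; rewrite (pass_form _ _ (type_of_enc u) (type_of_enc u')); apply/and3P; split.
- by apply/all_nodesP => j psi; apply: type_local.
- apply/all_nodesP => j psi Hj; have jw := nodew _ _ Hj; case ji : (j == i).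
  + rewrite (eqP ji) in Hj jw *; move: (D _ Hj).
    by case: (psi) => //= *; rewrite kE ?eqxx.
  + by case: (psi) => //= *; rewrite kE ?ji.
- apply/orP; case: E => [E|E]; [left|right]; apply/all_nodesP => j psi Hj.
  + have jw := nodew _ _ Hj; case ji : (j == i).
    * rewrite (eqP ji) in Hj jw *; move: (E _ Hj).
      by case: (psi) => //= *; rewrite kE ?eqxx.
    * by case: (psi) => //= *; rewrite kE ?ji.
  + by case: fwd E {D} => E; [|rewrite node_edge_rev]; apply: type_edge.
Qed.

Lemma type_no_conflicts u : ~~ conflicts (type_of u) (type_of u).
Proof.
apply/(no_conflictsP (type_of_enc u)) => i j iw jw _ _ pij.
by rewrite !bits_type_of //= /truth pij.
Qed.

Lemma type_survives (L : seq (seq asym)) N u : (forall u, type_of u \in L) ->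
  type_of u \in iter N round L.
Proof.
(* All worlds are treated at once: the witnesses for one type are types of other worlds, which must
   still be present. *)
move=> HL; elim: N u => [//|N IH] u; rewrite iterS /round mem_rev mem_filter IH andbT.
rewrite /good type_no_conflicts; apply/allP => x.
rewrite mem_iota -(size_map fst) type_of_enc => xw.
apply/andP; split; apply/hasP.
- by have [u' ?] := type_pass u true xw; exists (type_of u').
- by have [u' ?] := type_pass u false xw; exists (type_of u').
Qed.

End Completeness.

Definition accepted (L : seq (seq asym)) (N : nat) : bool :=
  has root_in_team (iter N round L).

Lemma accepted_fin_sat w L N : (forall t, t \in L -> map fst t = w) -> size L <= N ->
  accepted L N -> exists2 phi, fin_satisfiable phi & enc phi = w.
Proof.
move=> Lw LN /hasP [t tL rt].
have tw := Lw _ (iter_round_sub tL).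
have /andP [_ /allP /(_ 0)] := iter_round_good LN tL.
(* A word with a root bit is nonempty, so it has passed a comparison, and that comparison shows that
   the input is a formula. *)
have t0 : 0 < size t by case: (t) rt.
rewrite mem_iota /= add0n t0 => /(_ isT) /andP [/hasP [t' t'L Ht] _].
have [|phi phiE] := pass_parse name_bij _ Ht; first by rewrite tw (Lw _ (iter_round_sub t'L)).
exists phi; last by rewrite -phiE tw.
have Lphi s : s \in iter N round L -> map fst s = enc phi.
  by move/iter_round_sub/Lw => ->; rewrite -phiE tw.
have Lgood s : s \in iter N round L -> good (iter N round L) s by apply: iter_round_good.
exact: (@stable_fin_satisfiable phi _ Lphi Lgood (SeqSub tL)).
Qed.

Lemma sat_accepted phi L N : (forall t, map fst t = enc phi -> t \in L) ->
  satisfiable phi -> accepted L N.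
Proof.
move=> HL [M [T [[u Tu] H]]]; have [tm tm0 tmP] := holds_teams 0 H.
apply/hasP; exists (type_of phi tm u).
  by apply: (type_survives tmP) => v; apply: HL; apply: type_of_enc.
have := @bits_type_of M phi tm u 0 (len_gt0 phi); rewrite /bits_at /root_in_team.
case: (type_of _ _ _) (type_of_enc phi tm u) => [|c t] //=; first by case: (phi).
by move=> _ ->; apply/asboolP; rewrite tm0.
Qed.

Lemma accepted_SAT w L N : (forall t, t \in L <-> map fst t = w) -> size L <= N ->
  accepted L N <-> SAT name w.
Proof.
move=> Lw LN; split=> [H|[phi sat E]].
- have [|phi [M [T [_ T0 H']]] E] := accepted_fin_sat (w := w) _ LN H; first by move=> t /Lw.
  by exists phi => //; exists M, T.
- by apply: (@sat_accepted phi) => // t; rewrite E => /Lw.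
Qed.

Lemma accepted_FINSAT w L N : (forall t, t \in L <-> map fst t = w) -> size L <= N ->
  accepted L N <-> FINSAT name w.
Proof.
move=> Lw LN; split=> [H|[phi [M [T [_ T0 H]]] E]].
- by have [|phi sat E] := accepted_fin_sat (w := w) _ LN H; [move=> t /Lw | exists phi].
- by apply: (@sat_accepted phi) => [t|]; [rewrite E => /Lw|exists M, T].
Qed.

End Satisfiability.

(** * The elimination program *)

Ltac split_eqs :=
  repeat match goal with H : is_true (_ != _) |- _ => move/eqP: H => H end;
  repeat (match goal with |- context [@eq_op ?T ?x ?y] => case: (@eqP T x y) => ? end;
          subst; try congruence).

Ltac store_ext := let u := fresh "u" in apply: funext => u; rewrite ?updE; split_eqs.

Lemma post_eq T (Q : T -> Prop) x y : x = y -> Q x -> Q y.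
Proof. by move=> ->. Qed.

(** * Basic operations on stacks *)

Section StoreLemmas.
Variables (A W : finType) (k : nat).
Notation store := (store A W k).
Notation prog := (prog A W k).
Notation var := 'I_k.+1.
Implicit Types (s : store) (a b v : var).

Lemma upd_same s v l : upd s v l v = l.
Proof. by rewrite updE eqxx. Qed.

Lemma upd_id s v l : s v = l -> upd s v l = s.
Proof. by move=> <-; apply: funext => u; rewrite updE; case: eqP => [->|]. Qed.

Lemma upd_upd s v l l' : upd (upd s v l) v l' = upd s v l'.
Proof. by apply: funext => u; rewrite !updE; case: eqP. Qed.

Lemma upd_swap s a b l l' : a != b -> upd (upd s a l) b l' = upd (upd s b l') a l.
Proof.
by move=> ab; apply: funext => u; rewrite !updE; case: eqP => [->|//]; rewrite eq_sym (negbTE ab).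
Qed.

Lemma wp_seq B (p q : prog) s Q : wp B (Seq p q) s Q = wp B p s (fun s1 => wp B q s1 Q).
Proof. by []. Qed.

Lemma wp_if B t (p q : prog) s Q :
  wp B (If t p q) s Q = if t (tops s) then wp B p s Q else wp B q s Q.
Proof. by []. Qed.

Lemma wp_act B d s Q : wp B (Act d) s Q = Q (act d s).
Proof. by []. Qed.

Definition skip : prog := Act (fun _ _ => Keep A W).

Lemma wp_skip B s Q : wp B skip s Q = Q s.
Proof. by []. Qed.

Definition push v g : prog := Act (fun _ u => if u == v then Push g else Keep A W).

Lemma wp_push B v g s Q : wp B (push v g) s Q = Q (upd s v (g :: s v)).
Proof.
by rewrite wp_act; congr Q; apply: funext => u; rewrite /act updE; case: eqP => [->|].
Qed.

Definition push2 a b g : prog :=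
  Act (fun _ u => if (u == a) || (u == b) then Push g else Keep A W).

Lemma wp_push2 B a b g s Q : a != b ->
  wp B (push2 a b g) s Q = Q (upd (upd s a (g :: s a)) b (g :: s b)).
Proof.
move=> ab; rewrite wp_act; congr Q; apply: funext => u; rewrite /act !updE.
by case: (u =P b) => [->|_]; rewrite ?orbT ?orbF //; case: eqP => [->|].
Qed.

(* [st p] is the store after the symbols [p] have been popped, up to [v]. *)
Lemma wp_loop_prefix B v (body : A + W -> prog) s (st : seq (A + W) -> store) Q :
  size (s v) <= B -> st [::] = s ->
  (forall p c l (Q' : _ -> Prop), s v = p ++ c :: l ->
     Q' (upd (st (rcons p c)) v l) -> wp B (body c) (upd (st p) v l) Q') ->
  Q (upd (st (s v)) v [::]) -> wp B (Loop v body) s Q.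
Proof.
move=> sB st0 Hb HQ; rewrite wp_loopE; split=> //.
rewrite -{2}(upd_id (erefl (s v))) -{2}st0.
have: s v = [::] ++ s v by [].
move: {1 2}[::] {2 3 4}(s v) => p l; elim: l p => [|c l IH] p E /=.
  by rewrite E cats0 in HQ.
rewrite upd_upd; apply: (Hb _ _ _ _ E); rewrite upd_same; split=> //.
by apply: IH; rewrite cat_rcons.
Qed.

Definition clear v : prog := Loop v (fun _ => skip).

Lemma wp_clear B v s Q : size (s v) <= B -> Q (upd s v [::]) -> wp B (clear v) s Q.
Proof. by move=> sB HQ; apply: (wp_loop_prefix (st := fun=> s)). Qed.

Definition transfer a b : prog := Loop a (fun c => push b c).

Lemma wp_transfer B a b s Q : a != b -> size (s a) <= B ->
  Q (upd (upd s b (rev (s a) ++ s b)) a [::]) -> wp B (transfer a b) s Q.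
Proof.
move=> ab sB HQ; apply: (wp_loop_prefix (st := fun p => upd s b (rev p ++ s b))) => //.
  by rewrite upd_id.
move=> p c l Q' _; rewrite wp_push rev_rcons.
by apply: post_eq; store_ext.
Qed.

Variable tmp : var.

Definition copy a b : prog := Seq (transfer a tmp) (Loop tmp (fun c => push2 a b c)).

Lemma wp_copy B a b s Q : a != b -> a != tmp -> b != tmp -> s tmp = [::] ->
  size (s a) <= B -> Q (upd s b (s a ++ s b)) -> wp B (copy a b) s Q.
Proof.
move=> ab at_ bt t0 sB HQ; rewrite wp_seq; apply: wp_transfer => //; rewrite t0 cats0.
set s1 := upd _ _ _; have st : s1 tmp = rev (s a) by rewrite /s1 !updE; split_eqs.
apply: (wp_loop_prefix (st := fun p => upd (upd s1 a (rev p)) b (rev p ++ s b))).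
- by rewrite st size_rev.
- by rewrite /s1; store_ext.
- move=> p c l Q' _; rewrite wp_push2 // rev_rcons.
  by apply: post_eq; store_ext.
- by rewrite st revK; apply: post_eq HQ; rewrite /s1; store_ext.
Qed.

Definition copyrev a b : prog :=
  Seq (Loop a (fun c => push2 tmp b c)) (transfer tmp a).

Lemma wp_copyrev B a b s Q : a != b -> a != tmp -> b != tmp -> s tmp = [::] ->
  size (s a) <= B -> Q (upd s b (rev (s a) ++ s b)) -> wp B (copyrev a b) s Q.
Proof.
move=> ab at_ bt t0 sB HQ; rewrite wp_seq.
apply: (wp_loop_prefix (st := fun p => upd (upd s tmp (rev p)) b (rev p ++ s b))) => //.
- by store_ext.
- move=> p c l Q' _; rewrite wp_push2 1?eq_sym // rev_rcons.
  by apply: post_eq; store_ext.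
set s1 := upd _ _ _; have st : s1 tmp = rev (s a) by rewrite /s1 !updE; split_eqs.
apply: wp_transfer; rewrite ?st ?size_rev 1?eq_sym // revK.
have -> : s1 a = [::] by rewrite /s1 !updE; split_eqs.
by rewrite cats0; apply: post_eq HQ; rewrite /s1; store_ext.
Qed.

End StoreLemmas.

Section Program.

Definition work : finType := (asym + (item + (reg + option bool)))%type.
Notation G := (sym + work)%type.
Notation store := (store sym work 22).
Notation prog := (prog sym work 22).
Notation keep := (Keep sym work).

Definition gA (c : asym) : G := inr (inl c).
Definition gI (x : item) : G := inr (inr (inl x)).
Definition gR (r : reg) : G := inr (inr (inr (inl r))).
Definition gB (b : bool) : G := inr (inr (inr (inr (Some b)))).
Definition sep : G := inr (inr (inr (inr None))).

Definition item_of (o : option G) : option item :=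
  if o is Some (inr (inr (inl x))) then Some x else None.
Definition reg_of (o : option G) : reg :=
  if o is Some (inr (inr (inr (inl r)))) then r else reg0.
Definition bits_of (o : option G) : bits :=
  if o is Some (inr (inl c)) then c.2 else (false, false).
Definition flag_of (o : option G) : bool :=
  if o is Some (inr (inr (inr (inr (Some b))))) then b else false.
Definition bit_of (o : option G) : option bool :=
  if o is Some (inr (inl (SyBit b, _))) then Some b else None.

(* [vX]: the words that survive; [vNew]: those that survive the current round;
   [vY], [vY']: copies of [vX] consumed by the outer and the inner enumeration;
   [vT], [vT']: the two words compared, reversed, and [vA] a copy of [vT];
   [vK], [vK']: the marker and a copy; [vR], [vF], [vP]: the state of the scan;
   [vU], [vV], [vU'], [vV'], [vS]: the search for conflicting names. *)
Notation var i := (@Ordinal 23 i isT).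
Notation vIn := (var 0).     Notation vX := (var 1).
Notation vNew := (var 2).    Notation vY := (var 3).
Notation vY' := (var 4).     Notation vT := (var 5).
Notation vT' := (var 6).     Notation vA := (var 7).
Notation vK := (var 8).      Notation vK' := (var 9).
Notation vR := (var 10).     Notation vF := (var 11).
Notation vP := (var 12).     Notation vTmp := (var 13).
Notation vU := (var 14).     Notation vV := (var 15).
Notation vU' := (var 16).    Notation vV' := (var 17).
Notation vS := (var 18).     Notation vGood := (var 19).
Notation vFound := (var 20). Notation vCount := (var 21).
Notation vOut := (var 22).

Ltac lit := repeat match goal with
  |- context [@eq_op ?T (@Ordinal ?n ?i ?p) (@Ordinal ?n ?j ?q)] =>
    let b := eval vm_compute in (Nat.eqb i j) in
    change (@eq_op T (@Ordinal n i p) (@Ordinal n j q)) with b end; cbv beta iota.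

Ltac rd := rewrite /act /tops; cbv beta; rewrite ?updE; lit; rewrite /= ?updE; lit.

Ltac store_lit := let u := fresh "u" in
  apply: funext => u; rewrite ?updE /act /tops; cbv beta; rewrite ?updE;
  repeat match goal with |- context [@eq_op ?T u ?v] =>
    case: (@eqP T u v) => [?|_]; [subst u|]; lit; rewrite ?updE; lit end; rewrite /=; try done.

Notation skip := (@skip sym work 22).
Notation clear := (@clear sym work 22).
Notation transfer := (@transfer sym work 22).
Notation copy := (@copy sym work 22 vTmp).
Notation copyrev := (@copyrev sym work 22 vTmp).

Ltac wseq := cbv beta; rewrite wp_seq; cbv beta.

Definition cmp_prog (p : G) : prog :=
  if item_of (Some p) is Some x then
    Act (fun tp u =>
      if u == vR then Repl (gR (cmp_reg x (reg_of (tp vR)) (item_of (tp vF))))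
      else if u == vF then @Pop sym work else keep)
  else skip.

Lemma item_of_ohead F : item_of (ohead (map gI F)) = ohead F.
Proof. by case: F. Qed.

Lemma wp_cmp B P r F s Q : s vR = [:: gR r] -> s vF = map gI F -> s vP = map gI P ->
  size P <= B ->
  Q (upd (upd (upd s vR [:: gR (foldl cmp_step (r, F) P).1])
       vF (map gI (foldl cmp_step (r, F) P).2)) vP [::]) ->
  wp B (Loop vP cmp_prog) s Q.
Proof.
move=> sR sF sP PB HQ; rewrite wp_loopE sP size_map; split=> //.
elim: P r F s sR sF sP {PB} HQ => [|p P IH] r F s sR sF sP HQ.
  by apply: post_eq HQ; store_lit.
rewrite /= wp_act; split; first by rd.
apply: (IH _ (behead F)).
- by rd; rewrite sR sF item_of_ohead.
- by rd; rewrite sF behead_map.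
- by rd.
by apply: post_eq HQ; store_lit.
Qed.

Definition column_act (fwd : bool) (c : sym) (b : bits) : prog :=
  Act (fun tp u =>
    let r := reg_of (tp vR) in
    if u == vR then
      Repl (gR (step_reg fwd c b (bits_of (tp vT')) (flag_of (tp vK')) r (item_of (tp vF))))
    else if u == vF then
      if pops c then @Pop sym work
      else if pushes c r is Some x then Push (gI x) else keep
    else if u == vP then
      if pushesP c b (bits_of (tp vT')) r is Some x then Push (gI x) else keep
    else if (u == vT') || (u == vK') then @Pop sym work
    else keep).

Definition column_prog (fwd : bool) (g : G) : prog :=
  match g with
  | inr (inl (c, b)) =>
      if c is SyIncl then Seq (Loop vP cmp_prog) (column_act fwd c b) else column_act fwd c b
  | _ => skip
  end.

Definition head_bits (t : seq asym) : bits := (head (SyProp, (false, false)) t).2.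

Lemma wp_column_act B fwd c b r F P t K s Q :
  s vR = [:: gR r] -> s vF = map gI F -> s vP = map gI P ->
  s vT' = map gA t -> s vK' = map gB K ->
  (let: (r', F', P') := step_col fwd (c, b, head_bits t, head false K) (r, F, P) in
   Q (upd (upd (upd (upd (upd s vR [:: gR r']) vF (map gI F')) vP (map gI P'))
       vT' (map gA (behead t))) vK' (map gB (behead K)))) ->
  wp B (column_act fwd c b) s Q.
Proof.
move=> sR sF sP sT sK /= HQ; rewrite wp_act.
have tT : bits_of (ohead (map gA t)) = head_bits t by case: (t).
have tK : flag_of (ohead (map gB K)) = head false K by case: (K).
have tF : item_of (ohead (map gI F)) = ohead F by case: (F).
apply: post_eq HQ; store_lit.
- by rewrite sK behead_map.
- by rewrite sT behead_map.
- by rewrite sR sP sT tT /=; case: (pushesP _ _ _ _).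
- by rewrite sR sF; case: (pops c); rewrite /= ?behead_map //; case: (pushes _ _).
- by rewrite sR sT sK sF tT tK tF.
Qed.

Lemma wp_column B fwd c b r F P t K s Q :
  s vR = [:: gR r] -> s vF = map gI F -> s vP = map gI P ->
  s vT' = map gA t -> s vK' = map gB K -> size P <= B ->
  (let: (r', F', P') := scan_col fwd (c, b, head_bits t, head false K) (r, F, P) in
   Q (upd (upd (upd (upd (upd s vR [:: gR r']) vF (map gI F')) vP (map gI P'))
       vT' (map gA (behead t))) vK' (map gB (behead K)))) ->
  wp B (column_prog fwd (gA (c, b))) s Q.
Proof.
move=> sR sF sP sT sK PB; rewrite /scan_col /=.
case: c => [b0||||||||]; try exact: wp_column_act.
case E : (foldl cmp_step (r, F) P) => [r1 F1] HQ.
rewrite wp_seq; apply: (wp_cmp sR sF sP PB); rewrite E.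
apply: (@wp_column_act B fwd SyIncl b r1 F1 [::] t K); try by rd.
by apply: post_eq HQ; store_lit.
Qed.

(** A column adds at most one item to the two stacks together; this bounds the loop over [P] and the
    later clearing by the length of the word. *)
Lemma size_scan_col fwd z r F P :
  size (scan_col fwd z (r, F, P)).1.2 + size (scan_col fwd z (r, F, P)).2 <=
  (size F + size P).+1.
Proof.
have H r' F' P' : size (step_col fwd z (r', F', P')).1.2 + size (step_col fwd z (r', F', P')).2 <=
    (size F' + size P').+1.
  case: z => [[[c b] b'] k] /=.
  case: c => [b0||||||||] /=; rewrite ?size_behead; try lia.
  - by case: (pm r'); case: (top r') => //= *; lia.
  - by case: (top r') => //= *; lia.
rewrite /scan_col; case: z.1.1.1 => [b0||||||||]; try exact: H.
rewrite /=; have : size (foldl cmp_step (r, F) P).2 <= size F.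
  elim: (P) r F => [|p P' IH] r F //=; apply: (leq_trans (IH _ _)).
  by rewrite /= size_behead leq_pred.
by case: (foldl _ _ _) => r1 F1 /= le; apply: (leq_trans (H _ _ _)) => /=; lia.
Qed.

Lemma wp_scan B fwd t t' K r F P s Q :
  s vR = [:: gR r] -> s vF = map gI F -> s vP = map gI P ->
  s vT' = map gA t' -> s vK' = map gB K -> s vA = map gA t ->
  size F + size P + size t <= B ->
  (let: (r', F', P') := scan fwd t t' K (r, F, P) in
   forall lF lP, map gI F' = lF -> map gI P' = lP -> size lF <= B -> size lP <= B ->
   Q (upd (upd (upd (upd (upd (upd s vR [:: gR r']) vF lF) vP lP)
       vT' (drop (size t) (map gA t'))) vK' (drop (size t) (map gB K))) vA [::])) ->
  wp B (Loop vA (column_prog fwd)) s Q.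
Proof.
move=> sR sF sP sT sK sA sz HQ; rewrite wp_loopE sA size_map; split; first lia.
elim: t t' K r F P s sR sF sP sT sK sA sz HQ => [|[c b] t IH] t' K r F P s sR sF sP sT sK sA /= sz HQ.
  have := HQ _ _ (erefl _) (erefl _); rewrite !size_map !drop0 => {}HQ.
  by apply: post_eq (HQ _ _); try lia; store_lit.
apply: (@wp_column B fwd c b r F P t' K); try by rd.
- by lia.
have := size_scan_col fwd (c, b, head_bits t', head false K) r F P.
case E : (scan_col _ _ _) => [[r1 F1] P1] /= sz1; split; first by rd.
apply: (IH (behead t') (behead K) r1 F1 P1); try by rd.
- by lia.
rewrite -/(head_bits t') E in HQ.
case: (scan _ _ _ _ _) HQ => [[r' F'] P'] HQ lF lP eF eP sF' sP'.
apply: post_eq (HQ lF lP eF eP sF' sP').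
have dr T (l : seq T) n : drop n.+1 l = drop n (behead l) by case: l n => [|? ?] [].
by store_lit; rewrite dr behead_map.
Qed.

(** [vT] and [vK] are copied because the scan consumes its stacks and they are needed again for the
    next word. A marker shorter than the word reads as [false] beyond its end. *)
Definition pair_prog (fwd : bool) : prog :=
  Seq (copy vT vA) (Seq (copy vK vK') (Seq (push vR (gR reg0))
  (Seq (Loop vA (column_prog fwd)) (Seq
  (Act (fun tp u =>
     if u == vFound then
       if accepting (reg_of (tp vR)) (item_of (tp vF)) then Repl (gB true) else keep
     else if u == vR then @Pop sym work else keep))
  (Seq (clear vF) (Seq (clear vP) (Seq (clear vT') (clear vK')))))))).

Lemma wp_pair B fwd t t' K b s Q :
  s vT = rev (map gA t) -> s vT' = rev (map gA t') -> s vK = map gB K ->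
  s vFound = [:: gB b] -> s vA = [::] -> s vK' = [::] -> s vR = [::] -> s vF = [::] ->
  s vP = [::] -> s vTmp = [::] ->
  size t <= B -> size t' <= B -> size K <= B ->
  Q (upd (upd s vT' [::]) vFound [:: gB (b || pass fwd K t t')]) ->
  wp B (pair_prog fwd) s Q.
Proof.
move=> sT sT' sK sFound sA sK' sR sF sP sTmp tB t'B KB HQ.
rewrite /pair_prog wp_seq; apply: wp_copy => //; rewrite ?sT ?size_rev ?size_map //.
wseq; apply: wp_copy => //; try (by rd); rd; rewrite ?sK ?size_map //.
wseq; rewrite wp_push; rd; rewrite sR.
wseq; apply: (@wp_scan B fwd (rev t) (rev t') K reg0 [::] [::]); try by rd; rewrite ?sA ?sK' ?cats0 ?map_rev.
- by rewrite size_rev.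
rewrite /pass /accepting_state in HQ.
case: (scan _ _ _ _ _) HQ => [[r F] P] HQ lF lP eF eP lFB lPB; cbv beta.
wseq; rewrite wp_act; wseq; apply: wp_clear; first by rd.
wseq; apply: wp_clear; first by rd.
wseq; apply: wp_clear; first by rd; rewrite size_drop size_map size_rev; lia.
apply: wp_clear; first by rd; rewrite size_drop size_map; lia.
apply: post_eq HQ; store_lit.
by rewrite -eF item_of_ohead sFound; case: (accepting _ _); rewrite ?orbT ?orbF.
Qed.

Definition is_sep (g : G) : bool :=
  if g is inr (inr (inr (inr None))) then true else false.

Definition enc_words (L : seq (seq asym)) : seq G :=
  flatten [seq rcons (map gA t) sep | t <- L].

Lemma enc_words_cons t L : enc_words (t :: L) = map gA t ++ sep :: enc_words L.
Proof. by rewrite -cat_rcons. Qed.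

(** A word arrives on [dst] reversed, which is the order that the scan needs. *)
Definition words_prog (src dst : 'I_23) (p : prog) : prog :=
  Loop src (fun g => if is_sep g then p else push dst g).

Lemma wp_words B src dst p L s (st : seq (seq asym) -> store) Q :
  src != dst -> size (enc_words L) <= B -> s src = enc_words L ->
  st [::] = s -> (forall M, st M dst = [::]) ->
  (forall M t M' l (Q' : _ -> Prop), L = M ++ t :: M' -> Q' (upd (st (rcons M t)) src l) ->
     wp B p (upd (upd (st M) src l) dst (rev (map gA t))) Q') ->
  Q (upd (st L) src [::]) -> wp B (words_prog src dst p) s Q.
Proof.
move=> sd LB sL st0 std Hp HQ; rewrite wp_loopE sL; split=> //.
have -> : s = upd (st [::]) src (enc_words L) by rewrite -sL st0 upd_id.
have: L = [::] ++ L by [].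
move: {1 2}[::] {2 3 4}(L) => M M'; elim: M' M => [|t M' IH] M E /=.
  by rewrite E cats0 in HQ.
rewrite enc_words_cons.
(* The empty [dst] is written as an update, so that the induction over a word can start with nothing
   moved. *)
have -> : upd (st M) src (map gA t ++ sep :: enc_words M') =
    upd (upd (st M) src (map gA t ++ sep :: enc_words M')) dst (rev (map gA [::])).
  by rewrite [RHS]upd_id // updE eq_sym (negbTE sd) std.
have: t = [::] ++ t by [].
move: {1 2}[::] {2 3 4}(t) => t1 t2; elim: t2 t1 => [|c t2 IHt] t1 Et /=.
  rewrite cats0 in Et; rewrite -Et.
  rewrite upd_swap 1?eq_sym // upd_upd; apply: (Hp M t M') => //.
  rewrite upd_same; split=> //.
  by apply: IH; rewrite cat_rcons.
rewrite wp_push; split; first by rewrite !updE (negbTE sd) eqxx.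
have := IHt (rcons t1 c); rewrite cat_rcons => /(_ Et).
by apply: post_eq; rewrite map_rcons rev_rcons; store_ext.
Qed.

Definition demand_prog (fwd : bool) : prog :=
  Seq (push vFound (gB false)) (Seq (copy vX vY') (Seq (words_prog vY' vT' (pair_prog fwd))
  (Act (fun tp u =>
     if u == vGood then (if flag_of (tp vFound) then keep else Repl (gB false))
     else if u == vFound then @Pop sym work else keep)))).

Lemma size_mem_enc_words L t : t \in L -> size t < size (enc_words L).
Proof.
elim: L => // t' L IH; rewrite inE enc_words_cons size_cat /= size_map.
case/orP => [/eqP ->|/IH H]; first by rewrite addnS ltnS leq_addr.
by apply: (leq_trans H); rewrite addnS ltnW // ltnS leq_addl.
Qed.

Lemma wp_demand B fwd t L K b s Q :
  s vX = enc_words L -> s vT = rev (map gA t) -> s vK = map gB K -> s vGood = [:: gB b] ->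
  s vFound = [::] -> s vY' = [::] -> s vT' = [::] ->
  s vA = [::] -> s vK' = [::] -> s vR = [::] -> s vF = [::] -> s vP = [::] -> s vTmp = [::] ->
  size (enc_words L) <= B -> size t <= B -> size K <= B ->
  Q (upd s vGood [:: gB (b && has (pass fwd K t) L)]) ->
  wp B (demand_prog fwd) s Q.
Proof.
move=> sX sT sK sG sFd sY' sT' sA sK' sR sF sP sTmp LB tB KB HQ.
rewrite /demand_prog; wseq; rewrite wp_push sFd.
wseq; apply: wp_copy => //; try (by rd); first by rd; rewrite sX.
wseq; apply: (@wp_words B vY' vT' (pair_prog fwd) L _
  (fun M => upd (upd s vFound [:: gB (has (pass fwd K t) M)]) vY' (enc_words L))) => //.
- by rd; rewrite sX sY' cats0.
- by store_lit; rewrite sX sY' cats0.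
- move=> M t' M' l Q' E HQ'.
  apply: (@wp_pair B fwd t t' K (has (pass fwd K t) M)); try by rd.
  + have : t' \in L by rewrite E mem_cat inE eqxx orbT.
    by move/size_mem_enc_words => H; apply: ltnW; apply: leq_trans H LB.
  + apply: post_eq HQ'; rewrite has_rcons orbC; store_lit.
- rewrite wp_act; apply: post_eq HQ; store_lit.
  by rewrite sG; case: (has _ _); rewrite ?andbT ?andbF.
Qed.

(** [vS] is nonempty as long as the two names agree. If both end at the same step, the conflict is
    recorded; in that case, as after a mismatch, emptying [vS] disables the remaining steps. *)
Definition name_step (g : G) : prog :=
  Act (fun tp u =>
    let run := isSome (tp vS) in
    let bx := bit_of (Some g) in let by_ := bit_of (tp vV') in
    if u == vV' then @Pop sym work
    else if u == vS then
      if run && ~~ (isSome bx && (bx == by_)) then @Pop sym work else keep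
    else if u == vGood then
      if [&& run, ~~ isSome bx & ~~ isSome by_] then Repl (gB false) else keep
    else keep).

Definition bit_prefix' (t : seq asym) := bit_prefix (map fst t).

Lemma wp_name_loop B u v (run b : bool) s (Q : store -> Prop) :
  s vU' = map gA u ++ [:: sep] -> s vV' = map gA v -> s vS = nseq run sep ->
  s vGood = [:: gB b] -> size u < B -> size v <= B ->
  (forall l, size l <= B ->
     Q (upd (upd (upd (upd s vGood [:: gB (b && ~~ (run && (bit_prefix' u == bit_prefix' v)))])
         vS [::]) vV' l) vU' [::])) ->
  wp B (Loop vU' name_step) s Q.
Proof.
move=> sU sV sS sG uB vB HQ; rewrite wp_loopE sU size_cat size_map addn1; split=> //.
have bitE (t : seq asym) : bit_of (ohead (map gA t)) = ohead (bit_prefix' t).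
  by case: t => [|[[]]].
elim: u v run b s sU sV sS sG vB HQ {uB} => [|c u IH] v run b s sU sV sS sG vB HQ.
  rewrite /= wp_act; split; first by rd.
  apply: post_eq (HQ (behead (map gA v)) _); last by rewrite size_behead size_map; lia.
  store_lit; first by rewrite sV.
    by rewrite sS; case: (run).
  rewrite sV sS sG bitE /bit_prefix'; case: (run) => /=; rewrite ?andbT //.
  by case: (bit_prefix _) => [|? ?] /=; rewrite ?andbT ?andbF.
rewrite /= wp_act; split; first by rd.
set by_ := ohead (bit_prefix' v); set bx := bit_of (Some (gA c)).
apply: (IH (behead v) [&& run, isSome bx & bx == by_]
  (b && ~~ [&& run, ~~ isSome bx & ~~ isSome by_])).
- by rd.
- by rd; rewrite sV behead_map.
- rd; rewrite sV sS bitE -/bx -/by_; case: (run) => //=.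
  by case: (isSome bx && _).
- rd; rewrite sV sS sG bitE -/bx -/by_; case: (run) => /=; rewrite ?andbT //.
  by case: (_ && _); rewrite ?andbT ?andbF.
- by rewrite size_behead; lia.
move=> l lB; apply: post_eq (HQ l lB); store_lit.
have -> // : run && (bit_prefix' (c :: u) == bit_prefix' v) = [&& run, ~~ isSome bx & ~~ isSome by_]
  || [&& [&& run, isSome bx & bx == by_] & bit_prefix' u == bit_prefix' (behead v)].
  case: (run) => //=; rewrite /bx /by_; case: c {IH HQ sU bx} => [[b0||||||||] c] /=;
    case: v {sV vB by_ bitE} => [|[[b1||||||||] d] v] //=.
by rewrite negb_or; case: (b); rewrite ?andbT.
Qed.

(** The [sep] at the bottom of [vU'] ends a name that extends to the end of the word. *)
Definition names_prog : prog :=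
  Seq (push vU' sep) (Seq (copy vU vU') (Seq (copy vV vV') (Seq (push vS sep)
  (Seq (Loop vU' name_step) (clear vV'))))).

Lemma wp_names B u v b s Q : s vU = map gA u -> s vV = map gA v -> s vGood = [:: gB b] ->
  s vU' = [::] -> s vV' = [::] -> s vS = [::] -> s vTmp = [::] -> size u < B -> size v <= B ->
  Q (upd s vGood [:: gB (b && (bit_prefix' u != bit_prefix' v))]) ->
  wp B names_prog s Q.
Proof.
move=> sU sV sG sU' sV' sS sTmp uB vB HQ; rewrite /names_prog; wseq; rewrite wp_push sU'.
wseq; apply: wp_copy => //; try (by rd); first by rd; rewrite sU size_map ltnW.
wseq; apply: wp_copy => //; try (by rd); first by rd; rewrite sV size_map.
wseq; rewrite wp_push; wseq; apply: (@wp_name_loop B u v true b).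
- by rd; rewrite sU.
- by rd; rewrite sV sV' cats0.
- by rd; rewrite sS.
- by rd.
- by [].
- by [].
move=> l lB; apply: wp_clear; first by rd.
apply: post_eq HQ; store_lit.
Qed.

Definition clash (g h : G) : bool :=
  match g, h with
  | inr (inl (c, b)), inr (inl (d, b')) => [&& c == SyProp, d == SyProp & b.2 != b'.2]
  | _, _ => false
  end.

Arguments clash : simpl never.

Definition consistent_prog (g : G) : prog :=
  Seq (copyrev vT vV) (Loop vV (fun h => if clash g h then names_prog else skip)).

Lemma wp_consistent B c u t b s Q : s vU = map gA u -> s vT = rev (map gA t) ->
  s vGood = [:: gB b] -> s vV = [::] ->
  s vU' = [::] -> s vV' = [::] -> s vS = [::] -> s vTmp = [::] -> size u < B -> size t <= B ->
  Q (upd s vGood [:: gB (b && ~~ conflict_in c u t)]) ->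
  wp B (consistent_prog (gA c)) s Q.
Proof.
move=> sU sT sG sV sU' sV' sS sTmp uB tB HQ; rewrite /consistent_prog.
wseq; apply: wp_copyrev => //; first by rewrite sT size_rev size_map.
rewrite sT sV revK cats0 wp_loopE upd_same size_map; split=> //.
have {}HQ : Q (upd (upd s vGood [:: gB (b && ~~ conflict_in c u t)]) vV [::]).
  by apply: post_eq HQ; store_lit.
elim: t b s sU sG sU' sV' sS sTmp tB HQ {sT sV} => [|d v IH] b s sU sG sU' sV' sS sTmp tB HQ.
  by apply: post_eq HQ; store_lit; rewrite sG andbT.
rewrite /=; have clashE : conflict c u d v = clash (gA c) (gA d) && (bit_prefix' u == bit_prefix' v).
  by rewrite /conflict /clash /=; case: (c) => ? ?; case: (d) => ? ? /=; rewrite !andbA.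
case: ifP => cl; rewrite cl /= in clashE.
  apply: (@wp_names B u v b); try by rd.
  - by move: tB => /=; lia.
  split; first by rd.
  set b' := (b && _).
  have -> : upd (upd (upd s vV (map gA (d :: v))) vV (map gA v)) vGood [:: gB b'] =
    upd (upd s vGood [:: gB b']) vV (map gA v) by store_lit.
  apply: (IH b'); try by rd.
  - by apply: ltnW.
  apply: post_eq HQ; store_lit.
  by rewrite /= clashE negb_or /b' andbA.
rewrite wp_skip; split; first by rd.
rewrite upd_upd; apply: (IH b) => //; first by apply: ltnW.
by apply: post_eq HQ; rewrite /= clashE.
Qed.

(** * One round of elimination *)

Definition scratch : seq 'I_23 :=
  [:: vY'; vT'; vA; vK; vK'; vR; vF; vP; vTmp; vU; vV; vU'; vV'; vS; vGood; vFound].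

Definition idle (s : store) : Prop := forall v, v \in scratch -> s v = [::].

Lemma idle_upd s v l : v \notin scratch -> idle s -> idle (upd s v l).
Proof.
by move=> vs H u us; rewrite updE; case: eqP => [E|_]; [rewrite -E us in vs|apply: H].
Qed.

(** One loop serves two traversals: the popped symbols run through the word from left to right in
    search of conflicts, while the growing marker moves from right to left. *)
Definition position_prog (g : G) : prog :=
  Seq (consistent_prog g)
    (Seq (demand_prog true) (Seq (demand_prog false) (push vK (gB false)))).

Definition positions_prog : prog := Loop vU position_prog.

Definition process_prog : prog :=
  Seq (push vGood (gB true)) (Seq (push vK (gB true)) (Seq (copyrev vT vU)
  (Seq positions_prog (Seq (clear vK)
  (Seq (If (fun tp => flag_of (tp vGood))
         (Seq (push vNew sep) (transfer vT vNew)) (clear vT))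
       (clear vGood)))))).

Fixpoint good_from L t i (u : seq asym) : bool :=
  if u is c :: u' then
    ~~ conflict_in c u' t && has (pass true (marker i) t) L &&
    has (pass false (marker i) t) L && good_from L t i.+1 u'
  else true.

Lemma good_fromE L t : good_from L t 0 t = good L t.
Proof.
suff E u i : good_from L t i u = ~~ conflicts t u &&
    all (fun i => has (pass true (marker i) t) L && has (pass false (marker i) t) L)
      (iota i (size u)) by rewrite E.
by elim: u i => //= c u IH i; rewrite IH negb_or; btauto.
Qed.

Lemma wp_position_loop B L t u i b s Q :
  s vX = enc_words L -> s vT = rev (map gA t) ->
  (forall v, v \in scratch -> v \notin [:: vU; vK; vGood] -> s v = [::]) ->
  s vK = map gB (marker i) -> s vGood = [:: gB b] ->
  size (enc_words L) <= B -> size t < B -> i + size u < B ->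
  (forall K, size K <= B ->
    Q (upd (upd (upd s vGood [:: gB (b && good_from L t i u)]) vK K) vU [::])) ->
  s vU = map gA u -> wp_loop B vU position_prog Q (map gA u) s.
Proof.
move=> + + + + + LB tB; elim: u i b s => [|c u IH] i b s sX sT idl sK sG iB HQ sU.
  apply: post_eq (HQ (map gB (marker i)) _); last first.
    by rewrite size_map size_rcons size_nseq; move: iB => /=; lia.
  by store_lit; rewrite sG andbT.
rewrite /= /position_prog in iB HQ *.
wseq; apply: (@wp_consistent B c u t b); try (by rd); try (by rd; rewrite idl).
- lia.
- exact: ltnW.
wseq; apply: (@wp_demand B true t L (marker i) (b && ~~ conflict_in c u t));
  try (by rd); try (by rd; rewrite idl).
- exact: ltnW.
- by rewrite size_rcons size_nseq; lia.
set b1 := (b && _) && _.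
wseq; apply: (@wp_demand B false t L (marker i) b1); try (by rd); try (by rd; rewrite idl).
- exact: ltnW.
- by rewrite size_rcons size_nseq; lia.
set b2 := b1 && _.
rewrite wp_push; split; first by rd.
set s' := upd _ _ _.
have -> : s' = upd (upd (upd s vGood [:: gB b2]) vK (map gB (marker i.+1))) vU (map gA u).
  by rewrite /s'; store_lit; rewrite sK.
apply: (IH i.+1 b2); try by rd.
- move=> v vs; rewrite !inE !negb_or => /and3P [v1 v2 v3].
  by rewrite !updE (negbTE v1) (negbTE v2) (negbTE v3) idl // !inE !negb_or v1 v2.
- by rewrite addSn -addnS.
- move=> K KB; apply: post_eq (HQ K KB); store_lit.
  by rewrite /b2 /b1 !andbA.
Qed.

Lemma wp_positions B L t b s Q :
  s vX = enc_words L -> s vT = rev (map gA t) -> s vU = map gA t ->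
  (forall v, v \in scratch -> v \notin [:: vU; vK; vGood] -> s v = [::]) ->
  s vK = map gB (marker 0) -> s vGood = [:: gB b] ->
  size (enc_words L) <= B -> size t < B ->
  (forall K, size K <= B ->
    Q (upd (upd (upd s vGood [:: gB (b && good L t)]) vK K) vU [::])) ->
  wp B positions_prog s Q.
Proof.
move=> sX sT sU idl sK sG LB tB HQ.
rewrite /positions_prog wp_loopE sU size_map; split; first exact: ltnW.
by apply: (@wp_position_loop B L t t 0 b) => //; rewrite good_fromE.
Qed.

Lemma wp_process B L t s Q :
  s vX = enc_words L -> s vT = rev (map gA t) -> idle s ->
  size (enc_words L) <= B -> size t < B ->
  Q (upd (upd s vT [::]) vNew (if good L t then map gA t ++ sep :: s vNew else s vNew)) ->
  wp B process_prog s Q.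
Proof.
move=> sX sT idl LB tB HQ; rewrite /process_prog.
wseq; rewrite wp_push; wseq; rewrite wp_push; wseq; apply: wp_copyrev => //.
- by rd; rewrite idl.
- by rd; rewrite sT size_rev size_map ltnW.
wseq; apply: (@wp_positions B L t true); try (by rd); try by rd; rewrite idl.
- by rd; rewrite sT revK idl // cats0.
- move=> v vs; rewrite !inE !negb_or => /and3P [v1 v2 v3].
  by rewrite !updE (negbTE v1) (negbTE v2) (negbTE v3) idl.
move=> K KB /=.
wseq; apply: wp_clear; first by rd.
wseq; rewrite wp_if /tops; rd.
have szT : size (rev (map gA t)) <= B by rewrite size_rev size_map ltnW.
case: ifP HQ => gd HQ.
- wseq; rewrite wp_push; apply: wp_transfer => //; first by rd; rewrite sT.
  apply: wp_clear; first by rd; lia.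
  apply: post_eq HQ; store_lit; try by rewrite idl.
  by rewrite sT revK.
- apply: wp_clear; first by rd; rewrite sT.
  apply: wp_clear; first by rd; lia.
  by apply: post_eq HQ; store_lit; rewrite idl.
Qed.

(** [vX] is replaced only at the end, so all words of a round are tested against the same list. *)
Definition round_prog : prog :=
  Seq (copy vX vY) (Seq (words_prog vY vT process_prog)
  (Seq (clear vX) (Seq (transfer vNew vTmp) (transfer vTmp vX)))).

Lemma size_enc_words L : size (enc_words L) = \sum_(t <- L) (size t).+1.
Proof.
elim: L => [|t L IH]; first by rewrite big_nil.
by rewrite big_cons -IH enc_words_cons size_cat size_map /= addnS.
Qed.

Lemma size_enc_round L : size (enc_words (round L)) <= size (enc_words L).
Proof.
rewrite !size_enc_words /round (perm_big (filter (good L) L)) ?perm_rev //=.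
by rewrite big_filter [leqRHS](bigID (good L)) leq_addr.
Qed.

Lemma wp_round B L s Q : s vX = enc_words L -> idle s ->
  s vT = [::] -> s vY = [::] -> s vNew = [::] -> size (enc_words L) <= B ->
  Q (upd s vX (enc_words (round L))) -> wp B round_prog s Q.
Proof.
move=> sX idl sT sY sNew LB HQ; rewrite /round_prog.
wseq; apply: wp_copy => //; try (by rewrite idl); first by rewrite sX.
wseq; apply: (@wp_words B vY vT process_prog L _
  (fun M => upd (upd s vNew (enc_words (rev (filter (good L) M)))) vY (enc_words L))) => //.
- by rd; rewrite sX sY cats0.
- by store_lit; rewrite sX sY cats0.
- move=> M t M' l Q' E HQ'; apply: (@wp_process B L t); try by rd.
  + by do ?apply: idle_upd.
  + have : t \in L by rewrite E mem_cat inE eqxx orbT.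
    by move/size_mem_enc_words => H; apply: leq_trans H LB.
  apply: post_eq HQ'; store_lit.
  by rewrite filter_rcons; case: (good L t); rewrite ?rev_rcons ?enc_words_cons.
rewrite -/(round L); have rB : size (enc_words (round L)) <= B.
  exact: leq_trans (size_enc_round L) LB.
wseq; apply: wp_clear; first by rd; rewrite sX.
wseq; apply: wp_transfer => //.
apply: wp_transfer => //; first by rd; rewrite idl // cats0 size_rev.
apply: post_eq HQ; store_lit; try by rewrite idl.
by rewrite idl // !cats0 revK.
Qed.

(** * Generation of all annotated words *)

Definition push4 (f : bits -> G) : prog :=
  Act (fun _ u => if u == vU then Push (f (true, true))
                  else if u == vV then Push (f (true, false))
                  else if u == vU' then Push (f (false, true))
                  else if u == vV' then Push (f (false, false)) else keep).

(** A new symbol belongs at the end of a word, that is, just before its [sep]. The four auxiliary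
    stacks hold the variants in reverse, and moving them back restores the order. *)
Definition extend_prog (c : sym) : prog :=
  Seq (Loop vX (fun g => if is_sep g then Seq (push4 (fun b => gA (c, b))) (push4 (fun=> sep))
                         else push4 (fun=> g)))
  (Seq (transfer vU vX) (Seq (transfer vV vX) (Seq (transfer vU' vX) (transfer vV' vX)))).

Definition annotate (c : sym) (b : bits) (L : seq (seq asym)) := [seq rcons t (c, b) | t <- L].

Definition extend (L : seq (seq asym)) (c : sym) : seq (seq asym) :=
  annotate c (false, false) L ++ annotate c (false, true) L ++
  annotate c (true, false) L ++ annotate c (true, true) L.

Lemma enc_words_cat L1 L2 : enc_words (L1 ++ L2) = enc_words L1 ++ enc_words L2.
Proof. by rewrite /enc_words map_cat flatten_cat. Qed.

Definition insert (c : sym) (b : bits) (l : seq G) : seq G :=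
  flatten [seq if is_sep g then [:: gA (c, b); sep] else [:: g] | g <- l].

Lemma insert_enc_words c b L : insert c b (enc_words L) = enc_words (annotate c b L).
Proof.
have cat l1 l2 : insert c b (l1 ++ l2) = insert c b l1 ++ insert c b l2.
  by rewrite /insert map_cat flatten_cat.
elim: L => // t L IH; rewrite enc_words_cons -cat1s !cat IH [annotate _ _ _]/=.
rewrite enc_words_cons map_rcons cat_rcons; congr (_ ++ _).
by rewrite /insert; elim: (t) => //= d t' ->.
Qed.

Lemma wp_extend B c L s Q : s vX = enc_words L -> idle s ->
  size (enc_words L) + size L <= B ->
  Q (upd s vX (enc_words (extend L c))) -> wp B (extend_prog c) s Q.
Proof.
move=> sX idl LB HQ; rewrite /extend_prog.
have LB' b : size (rev (enc_words (annotate c b L))) <= B.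
  apply: leq_trans LB; rewrite size_rev !size_enc_words big_map -sum1_size -big_split /=.
  by apply: leq_sum => t _; rewrite size_rcons addn1.
wseq; apply: (wp_loop_prefix (st := fun p =>
  upd (upd (upd (upd s vU (rev (insert c (true, true) p))) vV (rev (insert c (true, false) p)))
    vU' (rev (insert c (false, true) p))) vV' (rev (insert c (false, false) p)))).
- by rewrite sX; apply: leq_trans LB; rewrite leq_addr.
- by store_lit; rewrite idl.
- move=> p g l Q' _ HQ'.
  have insE b : rev (insert c b (rcons p g)) =
      if is_sep g then [:: sep, gA (c, b) & rev (insert c b p)] else g :: rev (insert c b p).
    by rewrite /insert map_rcons flatten_rcons rev_cat; case: (is_sep g).
  case: ifP insE => gs insE.
  + wseq; rewrite wp_act wp_act; apply: post_eq HQ'; store_lit; by rewrite insE.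
  + rewrite wp_act; apply: post_eq HQ'; store_lit; by rewrite insE.
rewrite sX !insert_enc_words.
wseq; apply: wp_transfer => //; first by rd.
wseq; apply: wp_transfer => //; first by rd.
wseq; apply: wp_transfer => //; first by rd.
apply: wp_transfer => //; first by rd.
apply: post_eq HQ; store_lit; rewrite ?idl //.
by rewrite !revK cats0 /extend !enc_words_cat.
Qed.

Definition all_words (w : seq G) : seq (seq asym) :=
  foldl (fun L g => if g is inl c then extend L c else L) [:: [::]] w.

Lemma mem_extend L c t :
  t \in extend L c <-> exists t' b, t' \in L /\ t = rcons t' (c, b).
Proof.
rewrite /extend !mem_cat; split.
  by case/or4P => /mapP [t' t'L ->]; exists t'; eexists; (split; [exact: t'L|reflexivity]).
by move=> [t' [[[] []] [t'L ->]]]; apply/or4P;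
  [constructor 4|constructor 3|constructor 2|constructor 1]; apply: map_f.
Qed.

Lemma mem_all_words w t : t \in all_words (map inl w) <-> map fst t = w.
Proof.
elim/last_ind: w t => [|w c IH] t; first by rewrite /= inE; case: t.
rewrite /all_words map_rcons foldl_rcons -/(all_words _) mem_extend; split.
  by move=> [t' [b [/IH <- ->]]]; rewrite map_rcons.
case/lastP: t => [|t [d b]]; first by move/(congr1 size); rewrite size_rcons.
by rewrite map_rcons => /rcons_inj [/IH H <-]; exists t, b.
Qed.

Lemma size_all_words w : size (all_words (map inl w)) = 4 ^ size w.
Proof.
elim/last_ind: w => // w c IH.
rewrite /all_words map_rcons foldl_rcons -/(all_words _) size_rcons expnS -IH.
by rewrite /extend !size_cat !size_map; lia.
Qed.

Lemma size_enc_all_words w :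
  size (enc_words (all_words (map inl w))) = 4 ^ size w * (size w).+1.
Proof.
rewrite size_enc_words -size_all_words -sum1_size big_distrl /= big_seq [RHS]big_seq.
by apply: eq_bigr => t /mem_all_words <-; rewrite size_map mul1n.
Qed.

Definition generate_prog : prog :=
  Seq (push vX sep) (Loop vIn (fun g => if g is inl c then extend_prog c else skip)).

Lemma wp_generate B w s Q : s vIn = map inl w -> s vX = [::] -> idle s ->
  size w <= B -> 4 ^ size w * (size w).+2 <= B ->
  Q (upd (upd s vIn [::]) vX (enc_words (all_words (map inl w)))) ->
  wp B generate_prog s Q.
Proof.
move=> sIn sX idl wB WB HQ; rewrite /generate_prog; wseq; rewrite wp_push sX.
apply: (wp_loop_prefix (st := fun p => upd s vX (enc_words (all_words p)))).
- by rd; rewrite sIn size_map.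
- by [].
- move=> p g l Q' E HQ'; have : s vIn = p ++ g :: l by move: E; rd.
  rewrite sIn => {}E.
  have [w1 [c [w2 [wE pE gE]]]] : exists w1 c w2,
      [/\ w = w1 ++ c :: w2, p = map inl w1 & g = inl c].
    exists (take (size p) w).
    move: (congr1 (take (size p)) E) (congr1 (drop (size p)) E).
    rewrite -map_take -map_drop take_size_cat // drop_size_cat //.
    case: (drop (size p) w) (cat_take_drop (size p) w) => //= c w2 wE pE [gE _].
    by exists c, w2.
  rewrite gE; apply: (@wp_extend B c (all_words p)).
  + by rd.
  + by do ?apply: idle_upd.
  (* Per word: its symbols, its [sep] and the symbol being appended, hence the factor [(size w).+2]
     in the hypothesis. *)
  + rewrite pE size_enc_all_words size_all_words -mulnSr.
    apply: leq_trans WB; have le : size w1 <= size w by rewrite wE size_cat leq_addr.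
    by rewrite leq_mul // leq_pexp2l.
  + apply: post_eq HQ'; store_lit.
    by rewrite /all_words foldl_rcons gE.
apply: post_eq HQ; rd; rewrite sIn; store_lit.
Qed.

(** [vT] is nonempty strictly inside a word, so only the first symbol of each word is tested. *)
Definition final_prog (g : G) : prog :=
  if is_sep g then Act (fun _ u => if u == vT then @Pop sym work else keep)
  else Act (fun tp u =>
    if u == vT then (if tp vT is None then Push sep else keep)
    else if u == vOut then
      (if (tp vT, g) is (None, inr (inl (_, (true, _)))) then Push sep else keep)
    else keep).

Lemma wp_final B L s (Q : store -> Prop) : s vX = enc_words L -> s vT = [::] -> s vOut = [::] ->
  size (enc_words L) <= B ->
  (forall s', (s' vOut != [::]) = has root_in_team L -> Q s') ->
  wp B (Loop vX final_prog) s Q.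
Proof.
move=> sX sT sOut LB HQ; rewrite wp_loopE sX; split=> //.
have {}sOut : (s vOut != [::]) = false by rewrite sOut.
have {}HQ s' : (s' vOut != [::]) = false || has root_in_team L -> Q s' by apply: HQ.
move: false sOut HQ => b; elim: L b s sT {sX LB} => [|t L IH] b s sT sOut HQ.
  by apply: HQ; rewrite orbF.
rewrite enc_words_cons.
have {}sT : s vT = nseq false sep by [].
have {}HQ s' : (s' vOut != [::]) = b || (~~ false && root_in_team t) || has root_in_team L -> Q s'.
  by rewrite -orbA; apply: HQ.
move: false sT HQ => f; elim: t f b s sOut => [|[c [m v]] t IHt] f b s sOut sT HQ.
  rewrite /= wp_act; split; first by rd.
  apply: (IH b); [by rd; rewrite sT; case: (f)|by rd|].
  by move=> s' E; apply: HQ; rewrite E andbF orbF.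
rewrite /= wp_act; split; first by rd.
apply: (IHt true (b || ~~ f && m)).
- rd; rewrite sT; case: (f) => /=; first by rewrite orbF.
  by case: (m); rewrite ?orbT ?orbF.
- by rd; rewrite sT; case: (f).
- by move=> s' E; apply: HQ; rewrite E /= orbF.
Qed.

(** The copy of [vX] serves as a counter: it has at least one symbol per word, which is enough
    rounds for stabilization. *)
Definition main_prog : prog :=
  Seq generate_prog (Seq (copy vX vCount) (Seq (Loop vCount (fun _ => round_prog))
  (Loop vX final_prog))).

Lemma size_iter_round N L : size (enc_words (iter N round L)) <= size (enc_words L).
Proof. by elim: N => //= N IH; apply: leq_trans (size_enc_round _) IH. Qed.

(** The property is a parameter because one program decides both problems. *)
Lemma wp_main (w : seq sym) (P : Prop) :
  (forall L N, (forall t, t \in L <-> map fst t = w) -> size L <= N -> accepted L N <-> P) ->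
  wp (2 ^ (3 * size w + 1)) main_prog (@input_store sym work 22 w)
    (fun s => (s vOut != [::]) <-> P).
Proof.
move=> H; set B := 2 ^ _; set s := @input_store _ _ _ _.
have s0 v : v != vIn -> s v = [::].
  move=> vn; rewrite /s /input_store ifF //; apply: contraNF vn => /eqP ->.
  by apply/eqP/val_inj.
have idl : idle s by move=> v vs; apply: s0; apply: contraTneq vs => ->.
have WB : 4 ^ size w * (size w).+2 <= B.
  (* Origin of the exponent: with [n = size w], the lists need [4 ^ n * (n + 2)] symbols, and
     [n + 2 <= 2 ^ (n + 1)]. *)
  have -> : B = 4 ^ size w * 2 ^ (size w).+1.
    by rewrite /B -[4]/(2 ^ 2) -expnM -expnD; congr (2 ^ _); lia.
  by rewrite leq_mul2l ltn_expl ?orbT.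
set L := all_words (map inl w).
have LB : size (enc_words L) <= B.
  by apply: leq_trans WB; rewrite size_enc_all_words leq_mul2l ltnW ?orbT.
have wB : size w <= B.
  by apply: leq_trans WB; rewrite (leq_trans (leq_addr 2 _)) // addn2 leq_pmull // expn_gt0.
rewrite /main_prog; wseq; apply: (@wp_generate B w) => //; rewrite -/L.
wseq; apply: wp_copy => //; try (by rd; rewrite s0).
set N := size (enc_words L).
wseq; apply: (wp_loop_prefix (st := fun p =>
  upd (upd (upd s vIn [::]) vCount (enc_words L)) vX (enc_words (iter (size p) round L)))).
- by rd; rewrite s0 // cats0.
- by store_lit; rewrite s0 // cats0.
- move=> p g l Q' _ HQ'; apply: (@wp_round B (iter (size p) round L)); try (by rd); try by rd; rewrite s0.
  + by do ?apply: idle_upd.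
  + exact: leq_trans (size_iter_round _ _) LB.
  + by apply: post_eq HQ'; rewrite size_rcons; store_lit.
rd; rewrite s0 // cats0 -/N.
apply: (@wp_final B (iter N round L)); try (by rd); try by rd; rewrite s0.
- exact: leq_trans (size_iter_round _ _) LB.
move=> s' ->; apply: (H L N) => [t|]; first exact: mem_all_words.
by rewrite /N size_enc_words -sum1_size leq_sum.
Qed.

End Program.

(* [Pi] is countably infinite: [name] is a bijection onto the binary words,
   which also fixes how proposition symbols are written in the input. *)
Theorem theorem1 (Pi : Type) (name : Pi -> seq bool) (name_bij : bijective name) :
  EXPTIME (SAT name) /\ EXPTIME (FINSAT name).
Proof.
split; apply: (@prog_EXPTIME sym work 22 main_prog (@Ordinal 23 22 isT) _ 3 1) => w;
  apply: wp_main => L N.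
- exact: accepted_SAT.
- exact: accepted_FINSAT.
Qed.
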